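(* Let $\mathbf{u}\in\mathbf{H}_0(\mathrm{curl},\Omega)$ be the exact solution of \[ \mathcal{B}(\mathbf{u},\boldsymbol\psi)=(\mathbf{f},\boldsymbol\psi)_{L^2(\Omega)}\quad\text{for all }\boldsymbol\psi\in\mathbf{H}_0(\mathrm{curl},\Omega), \] and let $\mathbf{u}_H:=\pi_H^E(\mathbf{u})$. Then \[ \mathbf{u}=\mathbf{u}_H-(\mathcal{G}\circ\mathcal{L})(\mathbf{u}_H)+\mathcal{G}(\mathbf{f}), \] where $\mathcal{L}$ is the operator associated with $\mathcal{B}$ and $\mathcal{G}$ is the Corrector Green's Operator, both defined in the context.
   Context: Setting: $\Omega\subset\mathbb{R}^3$ is an open, bounded, contractible domain with polyhedral Lipschitz boundary; functions are complex-valued. $\mathbf{H}(\mathrm{curl})=\mathbf{H}(\mathrm{curl},\Omega)=\{\mathbf{v}\in L^2(\Omega,\mathbb{C}^3):\mathrm{curl}\,\mathbf{v}\in L^2\}$ with norm $\|\mathbf{v}\|^2_{\mathbf{H}(\mathrm{curl})}=\|\mathrm{curl}\,\mathbf{v}\|^2_{L^2}+\|\mathbf{v}\|^2_{L^2}$; $\mathbf{H}_0(\mathrm{curl})$ is its subspace with $\mathbf{v}\times\mathbf{n}=0$ on $\partial\Omega$; $\mathbf{H}(\mathrm{div})=\{\mathbf{v}\in L^2(\Omega,\mathbb{C}^3):\mathrm{div}\,\mathbf{v}\in L^2\}$ with graph norm. Data: $\mathbf{f}\in\mathbf{H}(\mathrm{div})$, $\mu\in L^\infty(\Omega,\mathbb{R}^{3\times3})$,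 $\kappa\in L^\infty(\Omega,\mathbb{C}^{3\times3})$, \[ \mathcal{B}(\mathbf{v},\boldsymbol\psi)=(\mu\,\mathrm{curl}\,\mathbf{v},\mathrm{curl}\,\boldsymbol\psi)_{L^2(\Omega)}+(\kappa\mathbf{v},\boldsymbol\psi)_{L^2(\Omega)} \] (complex $L^2$ inner products), which is continuous, and it is assumed that there is $\alpha>0$ with $|\mathcal{B}(\mathbf{v},\mathbf{v})|\ge\alpha\|\mathbf{v}\|^2_{\mathbf{H}(\mathrm{curl})}$ for all $\mathbf{v}\in\mathbf{H}_0(\mathrm{curl})$. $\mathbf{H}_0(\mathrm{curl})'$ is the space of bounded (antilinear, matching the second slot of $\mathcal{B}$) functionals; $\mathbf{f}$ is identified with $\mathbf{v}\mapsto(\mathbf{f},\mathbf{v})_{L^2(\Omega)}$. $\mathcal{L}:\mathbf{H}_0(\mathrm{curl})\to\mathbf{H}_0(\mathrm{curl})'$ is $\mathcal{L}(\mathbf{v})(\mathbf{w})=\mathcal{B}(\mathbf{v},\mathbf{w})$. Mesh and projection: $\mathcal{T}_H$ is a regular, shape-regular and quasi-uniform partition of $\overline\Omega$ into closed tetrahedra with mesh size $H=\max_T\mathrm{diam}(T)$; $\mathrm{N}(T)$ is the interior of the union of all elements intersecting $T$. $\mathring{\mathcal{N}}(\mathcal{T}_H)=\{\mathbf{v}\in\mathbf{H}_0(\mathrm{curl}):\mathbf{v}|_T(\mathbf{x})=\mathbf{a}_T\times\mathbf{x}+\mathbf{b}_T,\ \mathbf{a}_T,\mathbf{b}_T\in\mathbb{C}^3,\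 \forall T\in\mathcal{T}_H\}$ is the lowest order Nédélec space, and $\mathring{\mathcal{RT}}(\mathcal{T}_H)$ the lowest order Raviart--Thomas space with vanishing normal trace. $\pi_H^E:\mathbf{H}_0(\mathrm{curl})\to\mathring{\mathcal{N}}(\mathcal{T}_H)$ is the Falk--Winther projection, specified here by its properties: it is linear, the identity on $\mathring{\mathcal{N}}(\mathcal{T}_H)$, satisfies for all $T\in\mathcal{T}_H$ the bounds $\|\pi_H^E\mathbf{v}\|_{L^2(T)}\le C_\pi(\|\mathbf{v}\|_{L^2(\mathrm{N}(T))}+H\|\mathrm{curl}\,\mathbf{v}\|_{L^2(\mathrm{N}(T))})$ and $\|\mathrm{curl}\,\pi_H^E\mathbf{v}\|_{L^2(T)}\le C_\pi\|\mathrm{curl}\,\mathbf{v}\|_{L^2(\mathrm{N}(T))}$, with $C_\pi$ depending only on the mesh regularity, and there is a linear projection $\pi_H^F:\mathbf{H}_0(\mathrm{div})\to\mathring{\mathcal{RT}}(\mathcal{T}_H)$ with $\mathrm{curl}\,\pi_H^E\mathbf{v}=\pi_H^F(\mathrm{curl}\,\mathbf{v})$. Corrector Green's Operator: $\mathbf{W}:=\ker(\pi_H^E)\subset\mathbf{H}_0(\mathrm{curl})$ (a closed subspace), and $\mathcal{G}:\mathbf{H}_0(\mathrm{curl})'\to\mathbf{W}$ is defined by $\mathcal{B}(\mathcal{G}(\mathbf{F}),\mathbf{w})=\mathbf{F}(\mathbf{w})$ for all $\mathbf{w}\in\mathbf{W}$ (well-defined by Lax--Milgram--Babuška). *)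

(* Defs.v *)
From HB Require Import structures.
From mathcomp Require Import all_boot all_order all_algebra.
From mathcomp Require Import complex.
From mathcomp Require Import all_classical all_reals all_analysis.

Set Implicit Arguments.
Unset Strict Implicit.
Unset Printing Implicit Defensive.
Import Order.TTheory GRing.Theory Num.Theory.
Import numFieldNormedType.Exports.

Local Open Scope classical_set_scope.
Local Open Scope complex_scope.
Local Open Scope ring_scope.

(* Points of R^3 are triples, so that the product topology, Borel
   sigma-algebra and measure of the library apply; vectors are columns.
   Elements of L^2, H(curl), etc. are represented by functions on all of R^3 of
   which only the values on Om matter: equality of fields is aeq Om below. *)
Notation R3 R := (R * R * R)%type.
(* The same type, with the Borel sigma-algebra in the form (convertible to the
   one of R3 R) over which the library defines lebesgue_measure. *)
Notation mR3 R :=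
  (measurableTypeR R * measurableTypeR R * measurableTypeR R)%type.
Notation vfield R := (R3 R -> 'cV[R[i]]_3).
Notation dualfun R := (vfield R -> R[i]).

Section Euclidean.
Context {R : realType}.
Implicit Types (x y : R3 R) (A B : set (R3 R)).

Definition leb3 : {measure set (mR3 R) -> \bar R} :=
  ((@lebesgue_measure R \x @lebesgue_measure R) \x @lebesgue_measure R)%E.

Definition vec x : 'cV[R]_3 := \col_(i < 3) [:: x.1.1; x.1.2; x.2]`_i.

Definition unit_pt (i : 'I_3) : R3 R :=
  ((i == 0)%:R, (i == 1)%:R, (i == 2)%:R).

Definition edist x y : R := Num.sqrt (\sum_i (vec (x - y) i 0) ^+ 2).

Definition diam A : R := sup [set edist p.1 p.2 | p in A `*` A].

Definition bdry A : set (R3 R) := closure A `\` A°.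

(* Convex hull; the hull of the empty set is empty. *)
Definition chull A : set (R3 R) :=
  [set x | exists (n : nat) (p : 'I_n -> R3 R) (t : 'I_n -> R),
     [/\ forall i, A (p i), forall i, 0 <= t i,
         \sum_i t i = 1 & x = \sum_i t i *: p i]].

(* Indices in 'I_3 are added modulo 3. *)
Definition cross (K : comNzRingType) (a b : 'cV[K]_3) : 'cV[K]_3 :=
  \col_i (a (i + 1) 0 * b (i + 2) 0 - a (i + 2) 0 * b (i + 1) 0).

Definition cplx m n (a : 'M[R]_(m, n)) : 'M[R[i]]_(m, n) :=
  map_mx (fun r => r%:C) a.

End Euclidean.

Section Domain.
Context {R : realType}.
Implicit Types (Om : set (R3 R)).

Definition contractible Om :=
  exists (x0 : R3 R) (h : R * R3 R -> R3 R),
    [/\ Om x0,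
        {within `[0, 1] `*` Om, continuous h},
        forall t x, 0 <= t <= 1 -> Om x -> Om (h (t, x)),
        forall x, Om x -> h (0, x) = x
      & forall x, Om x -> h (1, x) = x0].

(* Near each boundary point, in suitable orthonormal coordinates, Om is the region strictly
   below the graph of a Lipschitz function and its boundary is that graph. *)
Definition lipschitz_boundary Om :=
  forall x, bdry Om x ->
  exists (Q : 'M[R]_3) (zeta : R -> R -> R) (L r h : R),
    [/\ Q *m Q^T = 1%:M, 0 < r, 0 < h,
        forall a b a' b',
          `|zeta a b - zeta a' b'| <= L * (`|a - a'| + `|b - b'|)
      & forall z, let y := Q *m vec (z - x) in
          y 0 0 ^+ 2 + y 1 0 ^+ 2 < r ^+ 2 -> `|y 2 0| < h ->
          (Om z <-> y 2 0 < zeta (y 0 0) (y 1 0)) /\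
          (bdry Om z <-> y 2 0 = zeta (y 0 0) (y 1 0))].

Definition polyhedral_boundary Om :=
  exists (n : nat) (p : 'I_n -> 'I_3 -> R3 R),
    bdry Om = \bigcup_k chull (range (p k)).

Definition admissible_domain Om :=
  [/\ open Om, bounded_set Om, contractible Om,
      lipschitz_boundary Om & polyhedral_boundary Om].

End Domain.

Section TestFunctions.
Context {R : realType}.
Implicit Types (phi : R3 R -> R) (Phi : R3 R -> 'cV[R]_3).

Definition partial (i : 'I_3) phi : R3 R -> R := 'D_(unit_pt i) phi.

Fixpoint Ck (n : nat) phi : Prop :=
  if n is m.+1 then
    (forall i x, derivable phi x (unit_pt i)) /\ (forall i, Ck m (partial i phi))
  else continuous phi.

Definition smooth phi := forall n, Ck n phi.

Definition compactly_supported (Om : set (R3 R)) phi :=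
  exists K : set (R3 R),
    [/\ compact K, K `<=` Om & forall x, ~ K x -> phi x = 0].

Definition grad phi : R3 R -> 'cV[R]_3 := fun x => \col_i partial i phi x.

Definition component Phi (i : 'I_3) : R3 R -> R := fun x => Phi x i 0.

Definition ccurl Phi : R3 R -> 'cV[R]_3 := fun x =>
  \col_i (partial (i + 1) (component Phi (i + 2)) x
          - partial (i + 2) (component Phi (i + 1)) x).

End TestFunctions.

Section Spaces.
Context {R : realType}.
Implicit Types (Om D : set (R3 R)) (v w c : vfield R) (q : R3 R -> R[i]).

Definition aeq Om v w := {ae leb3, forall x, Om x -> v x = w x}.

Definition cint D (h : R3 R -> R[i]) : R[i] :=
  (\int[leb3]_(x in D) complex.Re (h x)) +i*
  (\int[leb3]_(x in D) complex.Im (h x)).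

Definition cmeasurable D (h : R3 R -> R[i]) :=
  measurable_fun (D : set (mR3 R)) (fun x : mR3 R => complex.Re (h x)) /\
  measurable_fun (D : set (mR3 R)) (fun x : mR3 R => complex.Im (h x)).

Definition sqmod (z : R[i]) : R := complex.Re z ^+ 2 + complex.Im z ^+ 2.
Definition sqnorm (a : 'cV[R[i]]_3) : R := \sum_i sqmod (a i 0).

Definition L2 D v :=
  (forall i, cmeasurable D (fun x => v x i 0)) /\
  (\int[leb3]_(x in D) (sqnorm (v x))%:E < +oo)%E.

Definition L2s D q :=
  cmeasurable D q /\ (\int[leb3]_(x in D) (sqmod (q x))%:E < +oo)%E.

Definition L2norm D v : R := Num.sqrt (\int[leb3]_(x in D) sqnorm (v x)).

(* Linear in the first slot, antilinear in the second. *)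
Definition L2ip D v w : R[i] :=
  cint D (fun x => \sum_i v x i 0 * Num.conj (w x i 0)).

(* Bilinear pairings with real test fields and test functions; complex test
   functions would give the same definitions below, by linearity. *)
Definition pairing D v (Phi : R3 R -> 'cV[R]_3) : R[i] :=
  cint D (fun x => \sum_i v x i 0 * (Phi x i 0)%:C).
Definition spairing D q (phi : R3 R -> R) : R[i] :=
  cint D (fun x => q x * (phi x)%:C).

Definition is_weak_curl Om v c :=
  L2 Om c /\
  forall Phi : R3 R -> 'cV[R]_3,
    (forall i, smooth (component Phi i)) ->
    (forall i, compactly_supported Om (component Phi i)) ->
    pairing Om v (ccurl Phi) = pairing Om c Phi.

Definition is_weak_div Om v q :=
  L2s Om q /\
  forall phi : R3 R -> R, smooth phi -> compactly_supported Om phi ->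
    pairing Om v (grad phi) = - spairing Om q phi.

(* Determined up to a null set for v in Hcurl (resp. Hdiv), zero otherwise. *)
Definition curl Om v : vfield R := xget (cst 0) [set c | is_weak_curl Om v c].
Definition diverg Om v : R3 R -> R[i] :=
  xget (cst 0) [set q | is_weak_div Om v q].

Definition Hcurl Om v := L2 Om v /\ exists c, is_weak_curl Om v c.
Definition Hdiv Om v := L2 Om v /\ exists q, is_weak_div Om v q.

Definition Hcurl_norm Om v : R :=
  Num.sqrt (L2norm Om (curl Om v) ^+ 2 + L2norm Om v ^+ 2).

(* The traces n x v and v . n on the boundary of Om, as the functionals of
   smooth functions (not vanishing at the boundary) given by Green's formulas. *)
Definition tangential_trace Om v (Phi : R3 R -> 'cV[R]_3) : R[i] :=
  pairing Om (curl Om v) Phi - pairing Om v (ccurl Phi).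
Definition normal_trace Om v (phi : R3 R -> R) : R[i] :=
  spairing Om (diverg Om v) phi + pairing Om v (grad phi).

Definition H0curl Om v :=
  Hcurl Om v /\
  forall Phi, (forall i, smooth (component Phi i)) -> tangential_trace Om v Phi = 0.
Definition H0div Om v :=
  Hdiv Om v /\ forall phi, smooth phi -> normal_trace Om v phi = 0.

Definition is_linear_on Om (S : set (vfield R)) (P : vfield R -> vfield R) :=
  forall (a : R[i]) v w, S v -> S w -> aeq Om (P (a *: v + w)) (a *: P v + P w).

End Spaces.

Section Form.
Context {R : realType}.
Implicit Types (Om : set (R3 R)) (v w psi : vfield R) (F : dualfun R).
Implicit Types (mu : R3 R -> 'M[R]_3) (kappa : R3 R -> 'M[R[i]]_3).

Definition Linfty_real Om mu :=
  (forall i j,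
     measurable_fun (Om : set (mR3 R)) (fun x : mR3 R => mu x i j)) /\
  exists M : R, {ae leb3, forall x, Om x -> forall i j, `|mu x i j| <= M}.

Definition Linfty_complex Om kappa :=
  (forall i j, cmeasurable Om (fun x => kappa x i j)) /\
  exists M : R, {ae leb3, forall x, Om x -> forall i j, `|kappa x i j| <= M%:C}.

Definition Bform Om mu kappa v psi : R[i] :=
  L2ip Om (fun x => cplx (mu x) *m curl Om v x) (curl Om psi)
  + L2ip Om (fun x => kappa x *m v x) psi.

Definition coercive Om mu kappa (alpha : R) :=
  forall v, H0curl Om v ->
    (alpha * Hcurl_norm Om v ^+ 2)%:C <= `|Bform Om mu kappa v v|.

(* F belongs to the space of bounded antilinear functionals on H0curl Om *)
Definition H0curl_dual Om F :=
  (forall (a : R[i]) v w, H0curl Om v -> H0curl Om w ->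
     F (a *: v + w) = Num.conj a * F v + F w) /\
  exists C : R, forall v, H0curl Om v -> `|F v| <= (C * Hcurl_norm Om v)%:C.

Definition Lop Om mu kappa v : dualfun R := fun w => Bform Om mu kappa v w.

Definition of_field Om (f : vfield R) : dualfun R := fun v => L2ip Om f v.

End Form.

Section Mesh.
Context {R : realType} {N : nat}.
(* T k lists the four vertices of the k-th element. *)
Implicit Types (T : 'I_N -> 'I_4 -> R3 R) (Om : set (R3 R)) (k l : 'I_N).

Definition cell T k : set (R3 R) := chull (range (T k)).

Definition nondegenerate (p : 'I_4 -> R3 R) :=
  \det (\matrix_(i < 3, j < 3) vec (p (lift ord0 i) - p ord0) j 0) != 0.

Definition meshsize T : R := \big[Num.max/0]_k diam (cell T k).

Definition elt_patch T k : set (R3 R) :=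
  (\bigcup_(l in [set l | cell T k `&` cell T l !=set0]) cell T l)°.

(* No hanging nodes: two elements meet in the hull of their common vertices. *)
Definition regular_partition Om T :=
  [/\ forall k, nondegenerate (T k),
      \bigcup_k cell T k = closure Om,
      forall k l, k != l -> (cell T k)° `&` (cell T l)° = set0
    & forall k l, k != l ->
        cell T k `&` cell T l = chull (range (T k) `&` range (T l))].

Definition shape_regular T (gamma : R) :=
  forall k, exists (c : R3 R) (r : R),
    [/\ 0 < r, [set x | edist x c < r] `<=` cell T k
      & diam (cell T k) <= gamma * r].

Definition quasi_uniform T (gamma : R) :=
  forall k, meshsize T <= gamma * diam (cell T k).

Definition Ned Om T (v : vfield R) :=
  H0curl Om v /\
  forall k, exists a b : 'cV[R[i]]_3,
    aeq (cell T k) v (fun x => cross a (cplx (vec x)) + b).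

Definition RT Om T (v : vfield R) :=
  H0div Om v /\
  forall k, exists (a : R[i]) (b : 'cV[R[i]]_3),
    aeq (cell T k) v (fun x => a *: cplx (vec x) + b).

Record falk_winther Om T (C : R) (piE : vfield R -> vfield R) : Prop := {
  fw_range : forall v, H0curl Om v -> Ned Om T (piE v) ;
  fw_linear : is_linear_on Om (H0curl Om) piE ;
  fw_proj : forall v, Ned Om T v -> aeq Om (piE v) v ;
  fw_stable : forall v, H0curl Om v -> forall k,
    L2norm (cell T k) (piE v) <=
      C * (L2norm (elt_patch T k) v + meshsize T * L2norm (elt_patch T k) (curl Om v)) ;
  fw_curl_stable : forall v, H0curl Om v -> forall k,
    L2norm (cell T k) (curl Om (piE v)) <= C * L2norm (elt_patch T k) (curl Om v) ;
  fw_commute : exists piF : vfield R -> vfield R,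
    [/\ forall v, H0div Om v -> RT Om T (piF v),
        is_linear_on Om (H0div Om) piF,
        forall v, RT Om T v -> aeq Om (piF v) v
      & forall v, H0curl Om v -> aeq Om (curl Om (piE v)) (piF (curl Om v))] }.

End Mesh.

Section Corrector.
Context {R : realType}.

Definition Wker (Om : set (R3 R)) (piE : vfield R -> vfield R) (v : vfield R) :=
  H0curl Om v /\ aeq Om (piE v) (cst 0).

Definition corrector_green (Om : set (R3 R)) (mu : R3 R -> 'M[R]_3)
    (kappa : R3 R -> 'M[R[i]]_3) (piE : vfield R -> vfield R)
    (G : dualfun R -> vfield R) :=
  forall F, H0curl_dual Om F ->
    Wker Om piE (G F) /\
    forall w, Wker Om piE w -> Bform Om mu kappa (G F) w = F w.

End Corrector.

(* Main.v *)
(** The field e = u_H - G(L u_H) + G(f) - u is mapped to zero by pi_H^E, since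
    pi_H^E fixes u_H and kills the range W of G.  Hence e is an admissible test
    field in the equations defining G(L u_H) and G(f), and together with the
    equation for u these give B(e, e) = 0; coercivity then yields e = 0.

    Since [curl] is a choice among weak curls, linearity of B rests on the
    almost everywhere uniqueness of weak curls.  That is the fundamental lemma
    of the calculus of variations: the smooth bumps exp(-1/(n (x-s)(t-x))) on
    intervals increase to indicators of boxes, so an integrable function that is
    orthogonal to all test functions has zero integral on every box, hence on
    every Borel set. *)

Require Import Defs.
From HB Require Import structures.
From mathcomp Require Import all_boot all_order all_algebra.
From mathcomp Require Import complex.
From mathcomp Require Import all_classical all_reals all_analysis.
From mathcomp Require Import measurable_realfun ring lra.
Import Order.TTheory GRing.Theory Num.Theory.
Import numFieldNormedType.Exports.
Local Open Scope classical_set_scope.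
Local Open Scope complex_scope.
Local Open Scope ring_scope.

Set Implicit Arguments.
Unset Strict Implicit.
Unset Printing Implicit Defensive.

(** * Smooth functions with compact support *)

(** [corrector_green] says something about [G F] only once [F] lies in [H0curl_dual], so two
    boundedness estimates come before the identity. No sharp constant is wanted there, and a
    weighted arithmetic-geometric mean inequality stands in for Cauchy-Schwarz. Linearity of [curl]
    and of [piE] is available only almost everywhere and has to be carried through the integrals.
    Membership of e in H_0(curl) involves traces tested with smooth fields that need not vanish near
    the boundary; this is where boundedness of the domain enters, making all such fields square
    integrable. The exponential is chosen because every derivative stays in the family polynomial
    times y^(-k) exp(-1/y), which tends to 0 at y = 0: one derivative formula settles smoothness of
    all orders. The factor n flattens the bump, as exp(-1/(n c)) tends to 1 for each fixed c > 0.
    Since the bumps stay below 1, dominated convergence applies with majorant |g|. *)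

Section FlatExponential.
Context {R : realType}.
Implicit Types (k : nat) (y x : R).

(** The factor [y ^- k] is built in because differentiating exp(-1/y) produces exactly such factors;
    0 is the smooth continuation to y <= 0. *)
Definition flat_exp k y : R :=
  if 0 < y then y ^- k * expR (- y^-1) else 0.

(** One term of the exponential series, exp(1/y) >= y^-(k+1) / (k+1)!, gives this for y > 0. A
    linear bound suffices for every [k], since dividing by y merely raises [k] by one. *)
Lemma flat_exp_bound k y : `|flat_exp k y| <= k.+1`!%:R * `|y|.
Proof.
rewrite /flat_exp; case: ifPn => y0; last by rewrite normr0 mulr_ge0.
have iy0 : 0 <= y^-1 by rewrite invr_ge0 ltW.
rewrite ger0_norm; last by rewrite mulr_ge0 ?expR_ge0// invr_ge0 exprn_ge0// ltW.
rewrite gtr0_norm// expRN ler_pdivrMr ?expR_gt0// -mulrA -ler_pdivrMl ?ltr0n ?fact_gt0//.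
rewrite -ler_pdivrMl//.
apply: le_trans (expR_ge1Dxn k iy0).
by rewrite exprS exprVn mulrCA mulrC lerDr ler01.
Qed.

Lemma flat_exp_div k y : y != 0 -> y^-1 * flat_exp k y = flat_exp k.+1 y.
Proof.
rewrite /flat_exp => y0; case: ifPn => _; last by rewrite mulr0.
by rewrite mulrA exprS invfM.
Qed.

Lemma is_derive_flat_exp k y :
  is_derive y 1 (flat_exp k) (flat_exp k.+2 y - k%:R * flat_exp k.+1 y).
Proof.
have [y0|y0|->] := ltrgtP y 0.
- rewrite /flat_exp ltNge ltW//= mulr0 subrr.
  apply: (near_eq_is_derive (f := cst 0)).
  near=> z; rewrite ltNge ltW//=; near: z; exact: lt_nbhsl.
- have yn0 : y != 0 by rewrite gt_eqF.
  have ykn0 : y ^+ k != 0 by rewrite expf_neq0.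
  have dV : is_derive y 1 (fun z => (z ^+ k)^-1)
      (- (y ^+ k) ^- 2 *: (k%:R * y ^+ k.-1)).
    apply: (is_deriveV (f := fun z => z ^+ k)) => //.
    have -> : (fun z : R => z ^+ k) = horner 'X^k by apply/funext => z; rewrite hornerXn.
    apply: is_derive_eq (is_derive_poly _ _) _.
    by rewrite derivXn hornerMn hornerXn mulr_natl.
  have dE : is_derive y 1 (fun z => expR (- z^-1)) (expR (- y^-1) * y ^- 2).
    apply: (is_derive1_comp (f := expR) (g := fun z => - z^-1)).
    have dI : is_derive y 1 (fun z : R => z^-1) (- y ^- 2 *: 1) by exact: is_deriveV.
    apply: is_derive_eq (is_deriveN dI) _.
    by rewrite /GRing.scale /= mulr1 opprK.
  have dM := is_deriveM dV dE.
  have nf : \near y, ((fun z => (z ^+ k)^-1) * (fun z => expR (- z^-1))) y = flat_exp k y.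
    near=> z; rewrite /flat_exp ifT//; near: z; exact: lt_nbhsr.
  have dF := near_eq_is_derive nf dM.
  apply: is_derive_eq dF _. rewrite /flat_exp y0 /GRing.scale /=.
  case: k ykn0 {dV dM nf} => [|k] ykn0; rewrite ?exprS; first by field.
  by field; rewrite yn0 expf_neq0.
- rewrite {2 3}/flat_exp ltxx mulr0 subrr.
  (* At 0 the difference quotient of [flat_exp k] is [flat_exp k.+1 h], and the linear bound, here
     with constant (k+2)!, sends it to 0. *)
  have h0 : h^-1 *: (flat_exp k (h *: 1 + 0) - flat_exp k 0) @[h --> 0^'] --> (0:R).
    apply/cvgr0Pnorm_lt => e e0; near=> h.
    have hn0 : h != 0 by near: h; exact: nbhs_dnbhs_neq.
    rewrite {2}/flat_exp ltxx subr0 addr0 /GRing.scale /= mulr1 flat_exp_div//.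
    apply: le_lt_trans (flat_exp_bound _ _) _.
    rewrite mulrC -ltr_pdivlMr ?ltr0n ?fact_gt0//.
    near: h; apply: dnbhs0_lt; rewrite divr_gt0// ltr0n fact_gt0//.
  split; first by apply/cvg_ex; exists 0.
  exact/cvg_lim.
Unshelve. all: by end_near. Qed.

(* For fixed q this class of functions is closed under derivation. *)
Definition poly_flat (p q : {poly R}) k x : R := p.[x] * flat_exp k q.[x].

(** The product and chain rules give terms with exponents k, k+1 and k+2; factors q^2 and q in the
    numerators bring them all to k+2. Where q <= 0 both sides vanish. *)
Lemma is_derive_poly_flat p q k x :
  is_derive x 1 (poly_flat p q k)
    (poly_flat (p^`() * q ^+ 2 + p * q^`() * (1 - k%:R *: q)) q k.+2 x).
Proof.
have dq := is_derive_poly q x; have dp := is_derive_poly p x.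
have dE := is_derive1_comp (is_derive_flat_exp k q.[x]) dq.
have dM := is_deriveM dp dE.
apply: is_derive_eq (is_deriveM dp dE) _.

rewrite /poly_flat /GRing.scale /= expr2 !(hornerD, hornerN, hornerM, hornerZ, hornerC) /flat_exp.
case: ifPn => [q0|_]; last first.
  by rewrite !(mulr0, mul0r, subr0, addr0).
have qn0 : q.[x] != 0 by rewrite gt_eqF.
have qk : q.[x] ^+ k != 0 by rewrite expf_neq0.
rewrite !exprS. by field; rewrite qk.
Qed.

End FlatExponential.

Section TestFunctionBumps.
Context {R : realType}.
Implicit Types (h : R -> R) (a b x : R3 R).

(** [Ck] descends into partial derivatives, so the induction on the order has to range over a whole
    class stable under [partial]. *)
Lemma smooth_closed (S : set (R3 R -> R)) :
  (forall phi, S phi -> continuous phi) ->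
  (forall phi i x, S phi -> derivable phi x (unit_pt i)) ->
  (forall phi i, S phi -> S (partial i phi)) ->
  forall phi, S phi -> smooth phi.
Proof.
move=> Scont Sder Spart phi Sphi n; elim: n phi Sphi => [|n IHn] phi Sphi /=.
  exact: Scont.
by split=> [i x|i]; [exact: Sder | apply/IHn/Spart].
Qed.

(** The two difference quotients are the same function of s (s = 0 identifies the base values), so
    directional derivatives come from one-variable calculus. *)
Lemma is_derive_line (F : R3 R -> R) (x v : R3 R) (g : R -> R) (t dg : R) :
  (forall s, F (s *: v + x) = g (s + t)) -> is_derive t 1 g dg ->
  is_derive x v F dg.
Proof.
move=> Fg [dgex <-].
have E : (fun s : R => s^-1 *: ((F \o shift x) (s *: v) - F x)) =
         (fun s : R => s^-1 *: ((g \o shift t) (s *: 1) - g t)).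
  apply/funext => s /=; rewrite Fg /GRing.scale /= mulr1.
  by have := Fg 0; rewrite scale0r !add0r => ->.
by split; rewrite /derivable /derive E.
Qed.

Definition tensor h1 h2 h3 x : R := h1 x.1.1 * h2 x.1.2 * h3 x.2.

Lemma ord3_cases (i : 'I_3) : [\/ i = 0, i = 1 | i = 2].
Proof.
case: i => [[|[|[|//]]]] lti; [apply: Or31|apply: Or32|apply: Or33]; exact: val_inj.
Qed.

Lemma unit_ptE :
  (unit_pt 0 = (1, 0, 0) :> R3 R) * (unit_pt 1 = (0, 1, 0) :> R3 R) *
  (unit_pt 2 = (0, 0, 1) :> R3 R).
Proof. by []. Qed.

Lemma is_derive_tensor h1 h2 h3 d1 d2 d3 x :
  is_derive x.1.1 1 h1 d1 -> is_derive x.1.2 1 h2 d2 -> is_derive x.2 1 h3 d3 ->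
  [/\ is_derive x (unit_pt 0) (tensor h1 h2 h3) (d1 * h2 x.1.2 * h3 x.2),
      is_derive x (unit_pt 1) (tensor h1 h2 h3) (h1 x.1.1 * d2 * h3 x.2) &
      is_derive x (unit_pt 2) (tensor h1 h2 h3) (h1 x.1.1 * h2 x.1.2 * d3)].
Proof.
case: x => [[x1 x2] x3] /= D1 D2 D3; split.
- apply: is_derive_eq (is_derive_line (g := (h2 x2 * h3 x3) *: h1) _ (is_deriveZ _ D1)) _.
    move=> s; rewrite /tensor unit_ptE /= /GRing.scale /=.
    by rewrite !mulr1 !mulr0 !add0r /GRing.scale /=; ring.
  by rewrite /GRing.scale /=; ring.
- apply: is_derive_eq (is_derive_line (g := (h1 x1 * h3 x3) *: h2) _ (is_deriveZ _ D2)) _.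
    move=> s; rewrite /tensor unit_ptE /= /GRing.scale /=.
    by rewrite !mulr1 !mulr0 !add0r /GRing.scale /=; ring.
  by rewrite /GRing.scale /=; ring.
- apply: is_derive_eq (is_derive_line (g := (h1 x1 * h2 x2) *: h3) _ (is_deriveZ _ D3)) _.
    move=> s; rewrite /tensor unit_ptE /= /GRing.scale /=.
    by rewrite !mulr1 !mulr0 !add0r /GRing.scale /=; ring.
  by rewrite /GRing.scale /=; ring.
Qed.

Lemma continuous_tensor h1 h2 h3 :
  continuous h1 -> continuous h2 -> continuous h3 -> continuous (tensor h1 h2 h3).
Proof.
move=> c1 c2 c3 x; rewrite /tensor.
apply: cvgM; first apply: cvgM.
- apply: (@continuous_comp _ _ _ (fun y : R3 R => y.1.1) h1); last exact: c1.
  by apply: (@continuous_comp _ _ _ (fun y : R3 R => y.1) fst); exact: cvg_fst.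
- apply: (@continuous_comp _ _ _ (fun y : R3 R => y.1.2) h2); last exact: c2.
  by apply: (@continuous_comp _ _ _ (fun y : R3 R => y.1) snd); [exact: cvg_fst|exact: cvg_snd].
- apply: (@continuous_comp _ _ _ (fun y : R3 R => y.2) h3); last exact: c3.
  exact: cvg_snd.
Qed.

Lemma smooth_tensor_poly_flat (p q : 'I_3 -> {poly R}) (k : 'I_3 -> nat) :
  smooth (tensor (poly_flat (p 0) (q 0) (k 0)) (poly_flat (p 1) (q 1) (k 1))
                 (poly_flat (p 2) (q 2) (k 2))).
Proof.
(* The three factors carry independent parameters because a partial derivative alters only one of
   them. *)
pose S := [set phi : R3 R -> R | exists p1 q1 k1 p2 q2 k2 p3 q3 k3,
  phi = tensor (poly_flat p1 q1 k1) (poly_flat p2 q2 k2) (poly_flat p3 q3 k3)].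
have Dx p1 q1 k1 p2 q2 k2 p3 q3 k3 x := is_derive_tensor
  (is_derive_poly_flat p1 q1 k1 x.1.1) (is_derive_poly_flat p2 q2 k2 x.1.2)
  (is_derive_poly_flat p3 q3 k3 x.2).
apply: (@smooth_closed S); last first.
- by exists (p 0), (q 0), (k 0), (p 1), (q 1), (k 1), (p 2), (q 2), (k 2).
- move=> _ i [p1 [q1 [k1 [p2 [q2 [k2 [p3 [q3 [k3 ->]]]]]]]]].
  have [->|->|->] := ord3_cases i.
  (* The nine parameters stay open until matching with the derivative supplied by [Dx] fixes
     them. *)
  + do 9 eexists; apply/funext => x; rewrite /partial.
    by have [[_ ->] _ _] := Dx p1 q1 k1 p2 q2 k2 p3 q3 k3 x.
  + do 9 eexists; apply/funext => x; rewrite /partial.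
    by have [_ [_ ->] _] := Dx p1 q1 k1 p2 q2 k2 p3 q3 k3 x.
  + do 9 eexists; apply/funext => x; rewrite /partial.
    by have [_ _ [_ ->]] := Dx p1 q1 k1 p2 q2 k2 p3 q3 k3 x.
- move=> _ i x [p1 [q1 [k1 [p2 [q2 [k2 [p3 [q3 [k3 ->]]]]]]]]].
  have [[D1 _] [D2 _] [D3 _]] := Dx p1 q1 k1 p2 q2 k2 p3 q3 k3 x.
  have [->|->|->] := ord3_cases i; [exact: D1|exact: D2|exact: D3].
- move=> _ [p1 [q1 [k1 [p2 [q2 [k2 [p3 [q3 [k3 ->]]]]]]]]].
  have c p' q' k' : continuous (poly_flat p' q' k' : R -> R).
    move=> t; apply: differentiable_continuous; apply/derivable1_diffP.
    by have [] := is_derive_poly_flat p' q' k' t.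
  exact: continuous_tensor.
Qed.

Definition obox a b : set (R3 R) :=
  [set x | [/\ a.1.1 < x.1.1 < b.1.1, a.1.2 < x.1.2 < b.1.2 & a.2 < x.2 < b.2]].

Definition cbox a b : set (R3 R) :=
  [set x | [/\ a.1.1 <= x.1.1 <= b.1.1, a.1.2 <= x.1.2 <= b.1.2 & a.2 <= x.2 <= b.2]].

Lemma cboxE a b :
  cbox a b = (`[a.1.1, b.1.1] `*` `[a.1.2, b.1.2]) `*` `[a.2, b.2].
Proof.
apply/seteqP; split=> x /=; rewrite !in_itv /=.
  by case=> ? ? ?; split.
by case=> [[? ?] ?]; split.
Qed.

Lemma compact_cbox a b : compact (cbox a b).
Proof.
rewrite cboxE.
by apply: compact_setX; [apply: compact_setX|]; exact: segment_compact.
Qed.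

Lemma obox_cbox a b : obox a b `<=` cbox a b.
Proof.
move=> x [/andP[a1 b1] /andP[a2 b2] /andP[a3 b3]].
by split; apply/andP; split; exact: ltW.
Qed.

(* Meant for s < t; for t < s it is positive on ]t, s[. *)
Definition bump1 (s t : R) (n : nat) (y : R) : R :=
  flat_exp 0 (n.+1%:R * ((y - s) * (t - y))).

Lemma bump1_ge0 s t n y : 0 <= bump1 s t n y.
Proof.
rewrite /bump1 /flat_exp; case: ifP => // _.
by rewrite expr0 invr1 mul1r expR_ge0.
Qed.

Lemma bump1_le1 s t n y : bump1 s t n y <= 1.
Proof.
rewrite /bump1 /flat_exp; case: ifPn => y0; last exact: ler01.
by rewrite expr0 invr1 mul1r -[leRHS]expR0 ler_expR oppr_le0 invr_ge0 ltW.
Qed.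

Lemma bump1_out s t n y : s < t -> ~~ (s < y < t) -> bump1 s t n y = 0.
Proof.
move=> st; rewrite /bump1 /flat_exp; case: ifPn => //.
rewrite pmulr_rgt0// negb_and -!leNgt => yp /orP[ys|ty]; exfalso;
  move: yp; apply/negP; rewrite -leNgt.
  by rewrite mulr_le0_ge0// ?subr_le0// subr_ge0 (le_trans ys)// ltW.
by rewrite mulr_ge0_le0// ?subr_le0// subr_ge0 (le_trans _ ty)// ltW.
Qed.

Lemma bump1_cvg s t y : s < t ->
  (fun n => bump1 s t n y) @ \oo --> ((s < y < t)%R%:R : R).
Proof.
move=> st; have [/andP[sy yt]|out] := boolP (s < y < t); last first.
  rewrite (_ : (fun n => _) = cst 0); first exact: cvg_cst.
  by apply/funext => n; exact: bump1_out.
have c0 : 0 < (y - s) * (t - y) by rewrite mulr_gt0// subr_gt0.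
rewrite (_ : (fun n => _) = (fun n => expR (- (n.+1%:R^-1 * ((y - s) * (t - y))^-1)))); last first.
  apply/funext => n; rewrite /bump1 /flat_exp ifT; last exact: mulr_gt0.
  by rewrite expr0 invr1 mul1r invfM.
have : (fun n => expR (- (n.+1%:R^-1 * ((y - s) * (t - y))^-1))) @ \oo -->
    expR (- (0 * ((y - s) * (t - y))^-1)).
  apply: continuous_cvg; first exact: continuous_expR.
  apply: cvgN; apply: cvgMl; exact: cvg_harmonic.
by rewrite mul0r oppr0 expR0.
Qed.

Definition bump a b n : R3 R -> R :=
  tensor (bump1 a.1.1 b.1.1 n) (bump1 a.1.2 b.1.2 n) (bump1 a.2 b.2 n).

Definition nonempty_box a b := [/\ a.1.1 < b.1.1, a.1.2 < b.1.2 & a.2 < b.2].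

Lemma smooth_bump a b n : smooth (bump a b n).
Proof.
pose q (i : 'I_3) := n.+1%:R *: (('X - (vec a i 0)%:P) * ((vec b i 0)%:P - 'X)).
have := @smooth_tensor_poly_flat (fun=> 1) q (fun=> 0%N).
rewrite (_ : tensor _ _ _ = bump a b n)//.
apply/funext => x; rewrite /bump /tensor /poly_flat /bump1 /q !hornerC !mul1r.
by rewrite !(hornerZ, hornerM, hornerD, hornerN, hornerC, hornerX) !mxE /=.
Qed.

Lemma bump_ge0 a b n x : 0 <= bump a b n x.
Proof. by rewrite /bump /tensor !mulr_ge0// bump1_ge0. Qed.

Lemma bump_le1 a b n x : bump a b n x <= 1.
Proof. by rewrite /bump /tensor !mulr_ile1// ?mulr_ge0// ?bump1_ge0// bump1_le1. Qed.

Lemma bump_out a b n x : nonempty_box a b -> ~ obox a b x -> bump a b n x = 0.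
Proof.
move=> [ab1 ab2 ab3] /not_and3P nx; rewrite /bump /tensor.
by case: nx => /negP nx; [rewrite (bump1_out _ ab1 nx)|rewrite (bump1_out _ ab2 nx)|
  rewrite (bump1_out _ ab3 nx)]; rewrite !(mulr0, mul0r).
Qed.

Lemma bump_cvg a b x : nonempty_box a b ->
  (fun n => bump a b n x) @ \oo --> (\1_(obox a b) x : R).
Proof.
move=> [ab1 ab2 ab3].
have -> : \1_(obox a b) x = (a.1.1 < x.1.1 < b.1.1)%R%:R * (a.1.2 < x.1.2 < b.1.2)%R%:R
   * (a.2 < x.2 < b.2)%R%:R :> R.
  rewrite -!natrM !mulnb indicE; congr (_%:R); congr nat_of_bool.
  apply/idP/idP => [/set_mem[-> -> ->]//|/andP[/andP[h1 h2] h3]].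
  by apply/mem_set; split.
by apply: cvgM; [apply: cvgM|]; exact: bump1_cvg.
Qed.

Lemma compactly_supported_bump (Om : set (R3 R)) a b n :
  nonempty_box a b -> cbox a b `<=` Om -> compactly_supported Om (bump a b n).
Proof.
move=> ab sub; exists (cbox a b); split => //; first exact: compact_cbox.
by move=> x nx; apply: bump_out => // /obox_cbox.
Qed.

End TestFunctionBumps.

(** * Borel sets and null functions *)

Section BorelSetsOfSpace.
Context {R : realType}.
Implicit Types (a b c x : R3 R) (U A D : set (R3 R)).

Lemma measurable_obox a b : measurable (obox a b : set (mR3 R)).
Proof.
have -> : obox a b = (`]a.1.1, b.1.1[ `*` `]a.1.2, b.1.2[) `*` `]a.2, b.2[.
  apply/seteqP; split=> x /=; rewrite !in_itv /=.
    by case=> ? ? ?; split.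
  by case=> [[? ?] ?]; split.
by apply: measurableX; [apply: measurableX|]; exact: measurable_itv.
Qed.

Definition rat_pt (r : rat * rat * rat) : R3 R :=
  (ratr r.1.1, ratr r.1.2, ratr r.2).

(** The closed box, and not just the open one, lies in [U], so that bumps on it have compact support
    in [U]. *)
Definition inner_box U (k : (rat * rat * rat) * (rat * rat * rat)) :=
  nonempty_box (rat_pt k.1) (rat_pt k.2) /\ cbox (rat_pt k.1) (rat_pt k.2) `<=` U.

(** Rational corners make the family countable. This serves twice: open sets become measurable for
    the product sigma-algebra, and an almost everywhere statement can be proved box by box. *)
Lemma open_bigcup_obox U : open U ->
  U = \bigcup_(k in inner_box U) obox (rat_pt k.1) (rat_pt k.2).
Proof.
move=> oU; apply/seteqP; split=> [x Ux|x [k [_ kU] /obox_cbox /kU]//].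
have [e e0 eU] : exists2 e, 0 < e & ball x e `<=` U.
  by apply/nbhs_ballP; exact: open_nbhs_nbhs.
have lo (t : R) : exists q : rat, t - e < ratr q < t.
  have [|q] := @rat_in_itvoo R (t - e) t; first by rewrite ltrBlDr ltrDl.
  by rewrite in_itv /= => ?; exists q.
have hi (t : R) : exists q : rat, t < ratr q < t + e.
  have [|q] := @rat_in_itvoo R t (t + e); first by rewrite ltrDl.
  by rewrite in_itv /= => ?; exists q.
have [[a1 /andP[a1l a1r]] [b1 /andP[b1l b1r]]] := (lo x.1.1, hi x.1.1).
have [[a2 /andP[a2l a2r]] [b2 /andP[b2l b2r]]] := (lo x.1.2, hi x.1.2).
have [[a3 /andP[a3l a3r]] [b3 /andP[b3l b3r]]] := (lo x.2, hi x.2).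
exists ((a1, a2, a3), (b1, b2, b3)); last by split; apply/andP; split.
split.
  by split => /=; [exact: lt_trans a1r b1l|exact: lt_trans a2r b2l|exact: lt_trans a3r b3l].
move=> y [/= /andP[y1l y1r] /andP[y2l y2r] /andP[y3l y3r]]; apply: eU.
split; [split|]; rewrite /ball /= distrC ltr_distl; apply/andP; split.
- exact: lt_le_trans a1l y1l.
- exact: le_lt_trans y1r b1r.
- exact: lt_le_trans a2l y2l.
- exact: le_lt_trans y2r b2r.
- exact: lt_le_trans a3l y3l.
- exact: le_lt_trans y3r b3r.
Qed.

Lemma measurable_open U : open U -> measurable (U : set (mR3 R)).
Proof.
move=> oU; rewrite (open_bigcup_obox oU) bigcup_mkcond.
apply: countable_bigcupT_measurable => // k.
by case: ifPn => _; [exact: measurable_obox|exact: measurable0].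
Qed.

Lemma measurable_continuous (phi : R3 R -> R) D : continuous phi ->
  measurable (D : set (mR3 R)) -> measurable_fun (D : set (mR3 R)) (phi : mR3 R -> R).
Proof.
move=> cphi mD; apply: (@measurable_funS _ _ _ _ setT) => //.
apply: (measurability _ (RGenOpens.measurableE R)).
move=> _ [_ [s [t ->] <-]]; rewrite setTI; apply: measurable_open.
by move/continuousP : cphi; apply; exact: interval_open.
Qed.

Definition orthant c : set (R3 R) :=
  [set x | [/\ x.1.1 < c.1.1, x.1.2 < c.1.2 & x.2 < c.2]].

(** Each coordinate half-space is a countable union of orthants, so the coordinate maps, and with
    them the identity, are measurable for the generated sigma-algebra. Orthants are chosen because
    they are stable under intersection. *)
Lemma measurable_orthants :
  @measurable _ (mR3 R) = <<s range orthant >>.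
Proof.
apply/seteqP; split; last first.
  apply: smallest_sub; first exact: sigma_algebra_measurable.
  move=> _ [c _ <-].
  have -> : orthant c = (`]-oo, c.1.1[ `*` `]-oo, c.1.2[) `*` `]-oo, c.2[.
    apply/seteqP; split=> x /=; rewrite !in_itv /=.
      by case=> ? ? ?; split.
    by case=> [[? ?] ?]; split.
  by apply: measurableX; [apply: measurableX|]; exact: measurable_itv.
pose G := range orthant.
have ub (t : R) : exists n : nat, t < n%:R.
  by exists (Num.bound `|t|); apply: le_lt_trans (ler_norm t) (archi_boundP _).
have mG c : measurable (orthant c : set (g_sigma_algebraType G)).
  by apply: sub_sigma_algebra; exists c.
have m1 : measurable_fun [set: g_sigma_algebraType G] (fun x => x.1.1 : measurableTypeR R).
  apply: (measurability _ (RGenInftyO.measurableE R)).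
  move=> _ [_ [t ->] <-]; rewrite setTI.
  rewrite (_ : _ @^-1` _ = \bigcup_n orthant (t, n%:R, n%:R)).
    by apply: bigcupT_measurable => n; exact: mG.
  apply/seteqP; split=> x /=; rewrite in_itv /=; last by case=> n _ [].
  move=> xt; have [[n xn] [m xm]] := (ub x.1.2, ub x.2).
  by exists (maxn n m) => //; split => //=; rewrite natr_max lt_max ?xn ?xm ?orbT//.
have m2 : measurable_fun [set: g_sigma_algebraType G] (fun x => x.1.2 : measurableTypeR R).
  apply: (measurability _ (RGenInftyO.measurableE R)).
  move=> _ [_ [t ->] <-]; rewrite setTI.
  rewrite (_ : _ @^-1` _ = \bigcup_n orthant (n%:R, t, n%:R)).
    by apply: bigcupT_measurable => n; exact: mG.
  apply/seteqP; split=> x /=; rewrite in_itv /=; last by case=> n _ [].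
  move=> xt; have [[n xn] [m xm]] := (ub x.1.1, ub x.2).
  by exists (maxn n m) => //; split => //=; rewrite natr_max lt_max ?xn ?xm ?orbT//.
have m3 : measurable_fun [set: g_sigma_algebraType G] (fun x => x.2 : measurableTypeR R).
  apply: (measurability _ (RGenInftyO.measurableE R)).
  move=> _ [_ [t ->] <-]; rewrite setTI.
  rewrite (_ : _ @^-1` _ = \bigcup_n orthant (n%:R, n%:R, t)).
    by apply: bigcupT_measurable => n; exact: mG.
  apply/seteqP; split=> x /=; rewrite in_itv /=; last by case=> n _ [].
  move=> xt; have [[n xn] [m xm]] := (ub x.1.1, ub x.1.2).
  by exists (maxn n m) => //; split => //=; rewrite natr_max lt_max ?xn ?xm ?orbT//.
have mid : measurable_fun [set: g_sigma_algebraType G] (fun x => x : mR3 R).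
  by apply/measurable_fun_pairP; split => //; apply/measurable_fun_pairP; split.
by move=> A mA; have := mid measurableT A mA; rewrite setTI.
Qed.

Lemma setI_closed_orthants : setI_closed (range orthant).
Proof.
move=> _ _ [c _ <-] [d _ <-].
exists (Num.min c.1.1 d.1.1, Num.min c.1.2 d.1.2, Num.min c.2 d.2) => //.
by apply/seteqP; split=> x /=; rewrite /orthant /= !lt_min;
  [case=> /andP[-> ->] /andP[-> ->] /andP[-> ->]|case=> -[-> -> ->] [-> -> ->]].
Qed.

Lemma measurable_cbox c d : measurable (cbox c d : set (mR3 R)).
Proof.
rewrite cboxE.
by apply: measurableX; [apply: measurableX|]; exact: measurable_itv.
Qed.

Lemma leb3_cbox_fin c d : (leb3 (cbox c d) < +oo)%E.
Proof.
rewrite cboxE.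
have fin (s t : R) : lebesgue_measure `[s, t] \is a fin_num.
  by rewrite lebesgue_measure_itv /=; case: ifP.
have m (s t : R) : measurable (`[s, t] : set (measurableTypeR R)) by exact: measurable_itv.
have -> : leb3 ((`[c.1.1, d.1.1] `*` `[c.1.2, d.1.2]) `*` `[c.2, d.2]) =
    (lebesgue_measure `[c.1.1, d.1.1]%classic *
     lebesgue_measure `[c.1.2, d.1.2]%classic * lebesgue_measure `[c.2, d.2]%classic)%E.
  rewrite -(product_measure1E (@lebesgue_measure R) (@lebesgue_measure R) (m _ _) (m _ _)).
  by apply: product_measure1E; [exact: measurableX|exact: m].
by rewrite -ge0_fin_numE ?fin_numM// !mule_ge0.
Qed.

Lemma bounded_sub_cbox A : bounded_set A -> exists c d, A `<=` cbox c d.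
Proof.
move=> [M0 [_ M0A]]; pose M := M0 + 1.
have AM x : A x -> `|x| <= M by apply: M0A; rewrite ltrDl.
exists (- M, - M, - M), (M, M, M) => x /AM xM.
have : `|x.1.1| <= M /\ `|x.1.2| <= M /\ `|x.2| <= M.
  by move: xM; rewrite !ge_max => /andP[/andP[]].
by rewrite /cbox /= !ler_norml => -[? [? ?]].
Qed.

End BorelSetsOfSpace.

(** * The fundamental lemma of the calculus of variations *)

Section FundamentalLemma.
Context {R : realType}.
Implicit Types (a b : R3 R) (Om : set (R3 R)) (g : R3 R -> R).

(* Filter lemmas restated on R3 R, where the filter instance of leb3, which lives
   on mR3 R, is not inferred. *)
Lemma ae_leb3S (P Q : R3 R -> Prop) : (forall x, P x -> Q x) ->
  {ae leb3, forall x, P x} -> {ae leb3, forall x, Q x}.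
Proof. exact: (@filterS _ _ (ae_filter_ringOfSetsType (@leb3 R))). Qed.

Lemma ae_leb3S2 (P Q S : R3 R -> Prop) : (forall x, P x -> Q x -> S x) ->
  {ae leb3, forall x, P x} -> {ae leb3, forall x, Q x} ->
  {ae leb3, forall x, S x}.
Proof. exact: (@filterS2 _ _ (ae_filter_ringOfSetsType (@leb3 R))). Qed.

Lemma integral_obox_eq0 Om g a b : open Om ->
  (@leb3 R).-integrable (Om : set (mR3 R)) (EFin \o g) ->
  (forall phi, smooth phi -> compactly_supported Om phi ->
    \int[leb3]_(x in Om) (g x * phi x) = 0) ->
  nonempty_box a b -> cbox a b `<=` Om ->
  (\int[leb3]_(x in obox a b) (g x)%:E = 0)%E.
Proof.
move=> oOm ig gphi ab abOm.
have mOm := measurable_open oOm.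
have mg : measurable_fun (Om : set (mR3 R)) (g : mR3 R -> R).
  by apply/measurable_EFinP; exact: measurable_int ig.
have mbump n : measurable_fun (Om : set (mR3 R)) (bump a b n : mR3 R -> R).
  by apply: measurable_continuous => //; exact: (smooth_bump a b n 0%N).
have mgb n : measurable_fun (Om : set (mR3 R)) (fun x : mR3 R => g x * bump a b n x).
  exact: measurable_funM.
pose f_ n (x : mR3 R) := (g x * bump a b n x)%:E.
pose f (x : mR3 R) := (g x * \1_(obox a b) x)%:E.
have fE : (\int[leb3]_(x in Om) f x = \int[leb3]_(x in obox a b) (g x)%:E)%E.
  rewrite -[in RHS](setIidr (subset_trans (@obox_cbox _ a b) abOm)) integral_mkcondr.
  apply: eq_integral => x _; rewrite /f patchE indicE.
  by case: ifPn; rewrite ?mulr1 ?mulr0.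
have mf : measurable_fun (Om : set (mR3 R)) f.
  apply/measurable_EFinP; apply: measurable_funM => //.
  by apply: measurable_indic; exact: measurable_obox.
have f_cvg : {ae leb3, forall x, Om x -> f_ ^~ x @ \oo --> f x}.
  apply: aeW => x _; apply: cvg_EFin; first exact: nearW.
  by apply: cvgMr; exact: bump_cvg.
have f_dom : {ae leb3, forall x n, Om x -> (`|f_ n x| <= (abse \o (EFin \o g)) x)%E}.
  apply: aeW => x n _; rewrite /f_ /= lee_fin normrM ler_piMr//.
  by rewrite ger0_norm ?bump_ge0// bump_le1.
have [_ _] := dominated_convergence mOm (fun n => (measurable_EFinP _ _).2 (mgb n)) mf
  f_cvg (integrable_abse ig) f_dom.
rewrite fE => h.
have h0 : (fun n => \int[leb3]_(x in Om) f_ n x)%E = cst 0%E.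
  apply/funext => n.
  (* [gphi] speaks of a real integral, which is 0 by default also when the extended one is infinite;
     integrability excludes that case. *)
  have ifn : (@leb3 R).-integrable (Om : set (mR3 R)) (f_ n).
    apply: le_integrable (integrable_abse ig) => //.
      by apply/measurable_EFinP.
    move=> x _; rewrite /f_ /= lee_fin normrM normr_id ler_piMr//.
    by rewrite ger0_norm ?bump_ge0// bump_le1.
  have := gphi _ (smooth_bump a b n) (compactly_supported_bump n ab abOm).
  by rewrite /Rintegral => e; rewrite -(fineK (integrable_fin_num _ ifn))// e.
move: h; rewrite h0 => h; symmetry.
apply: (cvg_unique _ _ h) => //; exact: cvg_cst.
Qed.

(** Dynkin's pi-lambda argument, for the sets whose part inside the box carries zero integral of
    [g]. Intersecting with an orthant only lowers the upper corner of the box, which is why the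
    hypothesis speaks of boxes with lower corner [a]. *)
Lemma ae_eq0_obox g a b :
  (@leb3 R).-integrable (obox a b : set (mR3 R)) (EFin \o g) ->
  (forall c, nonempty_box a c -> cbox a c `<=` cbox a b ->
    (\int[leb3]_(x in obox a c) (g x)%:E = 0)%E) ->
  {ae leb3, forall x, obox a b x -> g x = 0}.
Proof.
move=> ig g0; pose B := obox a b : set (mR3 R).
have mB : measurable B := measurable_obox a b.
pose P (A : set (mR3 R)) := (\int[leb3]_(x in A `&` B) (g x)%:E = 0)%E.
have igA (A : set (mR3 R)) : measurable A ->
    (@leb3 R).-integrable (A `&` B) (EFin \o g).
  by move=> mA; apply: integrableS ig => //; exact: measurableI.
have empty c : ~ nonempty_box a c -> obox a c = set0.
  move=> nac; apply/seteqP; split=> // x [/andP[l1 r1] /andP[l2 r2] /andP[l3 r3]].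
  by apply: nac; split; [exact: lt_trans l1 r1|exact: lt_trans l2 r2|exact: lt_trans l3 r3].
have PG : range orthant `<=` P.
  move=> _ [c _ <-]; rewrite /P.
  pose d := (Num.min b.1.1 c.1.1, Num.min b.1.2 c.1.2, Num.min b.2 c.2).
  have -> : orthant c `&` B = obox a d.
    apply/seteqP; split=> x; rewrite /obox /= !lt_min.
      by case=> -[-> -> ->] [/andP[-> ->] /andP[-> ->] /andP[-> ->]]; split.
    case=> /andP[? /andP[? ?]] /andP[? /andP[? ?]] /andP[? /andP[? ?]].
    by do !split => //; apply/andP.
  have [ad|/empty ->] := pselect (nonempty_box a d); last by rewrite integral_set0.
  apply: g0 => // x; rewrite /cbox /= !le_min.
  case=> /andP[? /andP[? _]] /andP[? /andP[? _]] /andP[? /andP[? _]].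
  by split; apply/andP.
have PT : P setT.
  rewrite /P setTI; have [ab|/empty abE] := pselect (nonempty_box a b).
    exact: g0.
  by rewrite /B abE integral_set0.
have Pall (A : set (mR3 R)) : measurable A -> P A.
  rewrite measurable_orthants.
  apply: (dynkin_induction measurable_orthants setI_closed_orthants PT PG).
  - move=> S mS PS.
    have := PT; rewrite /P -{1}(setvU S) setIUl integral_setU //.
    + by rewrite [X in (_ + X)%E]PS adde0.
    + exact: measurableI (measurableC mS) mB.
    + exact: measurableI.
    + rewrite -setIUl setvU; exact: measurable_int (igA _ measurableT).
    + apply/disj_setPS => x [[nSx _] [Sx _]]; exact: nSx.
  - move=> F mF tF PF; rewrite /P setI_bigcupl integral_bigcup//.
    + by rewrite eseries0// => i _ _; exact: PF.
    + exact: trivIset_setIr.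
    + by move=> k; exact: measurableI.
    + by rewrite -setI_bigcupl; apply: igA; exact: bigcupT_measurable.
have : ae_eq leb3 B (EFin \o g) (cst 0%E).
  apply: (integral_ae_eq mB ig); first exact: measurable_cst.
  by move=> E EB mE; rewrite integral0 -(setIidl EB); exact: Pall.
by apply: ae_leb3S => x h Bx; have [] := h Bx.
Qed.

Lemma ae_eq0_test Om g : open Om ->
  (@leb3 R).-integrable (Om : set (mR3 R)) (EFin \o g) ->
  (forall phi, smooth phi -> compactly_supported Om phi ->
    \int[leb3]_(x in Om) (g x * phi x) = 0) ->
  {ae leb3, forall x, Om x -> g x = 0}.
Proof.
move=> oOm ig gphi.
have mOm := measurable_open oOm.
have g0 k : inner_box Om k ->
    {ae leb3, forall x, obox (rat_pt k.1) (rat_pt k.2) x -> g x = 0}.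
  move=> [kb kOm]; apply: ae_eq0_obox.
    apply: integrableS ig => //; first exact: measurable_obox.
    exact: subset_trans (@obox_cbox _ _ _) kOm.
  move=> c ac acb; apply: integral_obox_eq0 oOm ig gphi ac _.
  exact: subset_trans acb kOm.
(* [ae_foralln] exchanges the quantifiers for natural numbers, so the rational boxes are enumerated
   by their codes; for codes of no box and for boxes outside the family the claim is vacuous. *)
have : {ae leb3, forall x, forall (n : nat) k, unpickle n = Some k -> inner_box Om k ->
    obox (rat_pt k.1) (rat_pt k.2) x -> g x = 0}.
  apply: ae_foralln => n; case: (unpickle n) => [k|]; last exact: aeW.
  have [/g0 gk|nk] := pselect (inner_box Om k); last by apply: aeW => x k' [<-] /nk.
  by apply: ae_leb3S gk => x h k' [<-] _; exact: h.
apply: ae_leb3S => x h; rewrite {1}(open_bigcup_obox oOm) => -[k Omk kx].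
exact: (h (pickle k) k (pickleK k)).
Qed.

End FundamentalLemma.

(** * Complex square-integrable functions *)

Section ComplexIntegral.
Context {R : realType}.
Implicit Types (D : set (R3 R)) (h k q r : R3 R -> R[i]) (z w : R[i]).

Lemma ReD z w : complex.Re (z + w) = complex.Re z + complex.Re w.
Proof. by case: z; case: w. Qed.
Lemma ImD z w : complex.Im (z + w) = complex.Im z + complex.Im w.
Proof. by case: z; case: w. Qed.
Lemma ReM z w :
  complex.Re (z * w) = complex.Re z * complex.Re w - complex.Im z * complex.Im w.
Proof. by case: z; case: w. Qed.
Lemma ImM z w :
  complex.Im (z * w) = complex.Re z * complex.Im w + complex.Im z * complex.Re w.
Proof. by case: z; case: w. Qed.
Lemma Re_conj z : complex.Re (Num.conj z) = complex.Re z.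
Proof. by case: z. Qed.
Lemma Im_conj z : complex.Im (Num.conj z) = - complex.Im z.
Proof. by case: z. Qed.

Lemma sqmod_ge0 z : 0 <= sqmod z.
Proof. by rewrite addr_ge0 ?sqr_ge0. Qed.

Lemma sqmodM z w : sqmod (z * w) = sqmod z * sqmod w.
Proof. by rewrite /sqmod ReM ImM; ring. Qed.

Lemma sqmodD z w : sqmod (z + w) <= 2 * (sqmod z + sqmod w).
Proof.
rewrite /sqmod ReD ImD.
have := sqr_ge0 (complex.Re z - complex.Re w).
have := sqr_ge0 (complex.Im z - complex.Im w).
by nra.
Qed.

Lemma sqmod_eq0 z : sqmod z = 0 -> z = 0.
Proof.
move=> /eqP; rewrite paddr_eq0 ?sqr_ge0// !sqrf_eq0 => /andP[/eqP zr /eqP zi].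
by case: z zr zi => a b /= -> ->.
Qed.

Lemma sqmod_le_norm z (M : R) : `|z| <= M%:C -> sqmod z <= M ^+ 2.
Proof.
case: z => a b; rewrite /Num.norm /= lecE /= => /andP[_ h].
have s0 : 0 <= a ^+ 2 + b ^+ 2 by rewrite addr_ge0 ?sqr_ge0.
rewrite /sqmod /= -(sqr_sqrtr s0).
by rewrite ler_sqr ?nnegrE ?sqrtr_ge0// (le_trans (sqrtr_ge0 _) h).
Qed.

Lemma norm_le_ReIm z (M : R) : `|complex.Re z| + `|complex.Im z| <= M -> `|z| <= M%:C.
Proof.
case: z => a b /= h; rewrite /Num.norm /= lecE /= eqxx /=.
have M0 : 0 <= M by rewrite (le_trans _ h)// addr_ge0.
rewrite -[leRHS](ger0_norm M0) -sqrtr_sqr ler_sqrt ?sqr_ge0//.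
apply: le_trans (_ : (`|a| + `|b|) ^+ 2 <= _).
  by rewrite sqrrD !real_normK ?num_real// lerD2r lerDl mulrn_wge0 ?mulr_ge0.
by rewrite ler_sqr ?nnegrE ?addr_ge0.
Qed.

(** Expand the nonnegative quantities t^-1 ((ta + c)^2 + (tb + d)^2) and t^-1 ((ta - c)^2 + (tb -
    d)^2). The free weight t later turns a sum of squares into a bound linear in one norm. *)
Lemma weighted_AGM (t a b c d : R) : 0 < t ->
  `|a * c + b * d| <= t * (a ^+ 2 + b ^+ 2) + t^-1 * (c ^+ 2 + d ^+ 2).
Proof.
move=> t0; have s0 : 0 < t^-1 by rewrite invr_gt0.
have p : 0 <= t^-1 * ((t * a + c) ^+ 2 + (t * b + d) ^+ 2).
  by rewrite mulr_ge0 ?(ltW s0)// addr_ge0 ?sqr_ge0.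
have m : 0 <= t^-1 * ((t * a - c) ^+ 2 + (t * b - d) ^+ 2).
  by rewrite mulr_ge0 ?(ltW s0)// addr_ge0 ?sqr_ge0.
have tn0 : t != 0 by rewrite gt_eqF.
have ep : t^-1 * ((t * a + c) ^+ 2 + (t * b + d) ^+ 2) =
    t * (a ^+ 2 + b ^+ 2) + t^-1 * (c ^+ 2 + d ^+ 2) + 2 * (a * c + b * d) by field.
have em : t^-1 * ((t * a - c) ^+ 2 + (t * b - d) ^+ 2) =
    t * (a ^+ 2 + b ^+ 2) + t^-1 * (c ^+ 2 + d ^+ 2) - 2 * (a * c + b * d) by field.
rewrite ep in p; rewrite em in m.
by rewrite ler_norml; apply/andP; split; lra.
Qed.

Lemma mul_conj_bound (t : R) z w : 0 < t ->
  `|complex.Re (z * Num.conj w)| <= t * sqmod z + t^-1 * sqmod w /\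
  `|complex.Im (z * Num.conj w)| <= t * sqmod z + t^-1 * sqmod w.
Proof.
case: z => a b; case: w => c d t0; rewrite ReM ImM Re_conj Im_conj /sqmod /=; split.
  by rewrite mulrN opprK; exact: weighted_AGM.
(* The imaginary part bc - ad is the dot product of (b, a) and (c, -d), with the same sums of
   squares. *)
have := weighted_AGM b a c (- d) t0.
by rewrite sqrrN (addrC (b ^+ 2)) (addrC (b * c)).
Qed.

Lemma cmeasurableD D h k : cmeasurable D h -> cmeasurable D k ->
  cmeasurable D (fun x => h x + k x).
Proof.
move=> [hr hi] [kr ki]; split.
  by under eq_fun do rewrite ReD; exact: measurable_funD.
by under eq_fun do rewrite ImD; exact: measurable_funD.
Qed.

Lemma cmeasurableM D h k : cmeasurable D h -> cmeasurable D k ->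
  cmeasurable D (fun x => h x * k x).
Proof.
move=> [hr hi] [kr ki]; split.
  under eq_fun do rewrite ReM.
  by apply: measurable_funB; exact: measurable_funM.
under eq_fun do rewrite ImM.
by apply: measurable_funD; exact: measurable_funM.
Qed.

Lemma cmeasurable_conj D h : cmeasurable D h ->
  cmeasurable D (fun x => Num.conj (h x)).
Proof.
move=> [hr hi]; split; first by under eq_fun do rewrite Re_conj.
by under eq_fun do rewrite Im_conj; exact: measurableT_comp hi.
Qed.

Lemma cmeasurable_cst D z : cmeasurable D (fun=> z).
Proof. by split; exact: measurable_cst. Qed.

Lemma measurable_sqmod D h : cmeasurable D h ->
  measurable_fun (D : set (mR3 R)) (fun x : mR3 R => sqmod (h x)).
Proof. by move=> [hr hi]; apply: measurable_funD; exact: measurable_funX. Qed.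

Definition cintegrable D h :=
  (@leb3 R).-integrable (D : set (mR3 R)) (EFin \o (fun x => complex.Re (h x))) /\
  (@leb3 R).-integrable (D : set (mR3 R)) (EFin \o (fun x => complex.Im (h x))).

Variable D : set (R3 R).
Hypothesis mD : measurable (D : set (mR3 R)).

Lemma cintegrable_cmeasurable h : cintegrable D h -> cmeasurable D h.
Proof.
move=> [hr hi]; split; apply/measurable_EFinP; first exact: measurable_int hr.
exact: measurable_int hi.
Qed.

Lemma cintegrableD h k : cintegrable D h -> cintegrable D k ->
  cintegrable D (fun x => h x + k x).
Proof.
move=> [hr hi] [kr ki]; split.
  rewrite (_ : _ \o _ = (EFin \o (fun x => complex.Re (h x))) \+
                        (EFin \o (fun x => complex.Re (k x))))%E.
    exact: integrableD.
  by apply/funext => x /=; rewrite ReD EFinD.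
rewrite (_ : _ \o _ = (EFin \o (fun x => complex.Im (h x))) \+
                        (EFin \o (fun x => complex.Im (k x))))%E.
  exact: integrableD.
by apply/funext => x /=; rewrite ImD EFinD.
Qed.

Lemma cintegrable0 : cintegrable D (fun=> 0).
Proof. by split; exact: integrable0. Qed.

Lemma cintegrable_sum (I : Type) (s : seq I) (h : I -> R3 R -> R[i]) :
  (forall i, cintegrable D (h i)) -> cintegrable D (fun x => \sum_(i <- s) h i x).
Proof.
move=> ih; elim: s => [|i s IHs].
  by under eq_fun do rewrite big_nil; exact: cintegrable0.
by under eq_fun do rewrite big_cons; exact: cintegrableD.
Qed.

Lemma cint_linear (a : R[i]) h k : cintegrable D h -> cintegrable D k ->
  cint D (fun x => a * h x + k x) = a * cint D h + cint D k.
Proof.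
have EFinZ (c : R) (u : R3 R -> R) :
  (@leb3 R).-integrable (D : set (mR3 R)) (EFin \o u) ->
  (@leb3 R).-integrable (D : set (mR3 R)) (EFin \o (fun x => c * u x)).
  by move=> iu; have := integrableZl mD c iu.
have EFinS (u v : R3 R -> R) :
  (@leb3 R).-integrable (D : set (mR3 R)) (EFin \o u) ->
  (@leb3 R).-integrable (D : set (mR3 R)) (EFin \o v) ->
  (@leb3 R).-integrable (D : set (mR3 R)) (EFin \o (fun x => u x + v x)).
  by move=> iu iv; have := integrableD mD iu iv.
have EFinSB (u v : R3 R -> R) :
  (@leb3 R).-integrable (D : set (mR3 R)) (EFin \o u) ->
  (@leb3 R).-integrable (D : set (mR3 R)) (EFin \o v) ->
  (@leb3 R).-integrable (D : set (mR3 R)) (EFin \o (fun x => u x - v x)).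
  by move=> iu iv; have := integrableB mD iu iv.
move=> [hr hi] [kr ki]; apply/eqP; rewrite eq_complex; apply/andP; split; apply/eqP.
  rewrite ReD ReM /=.
  under eq_Rintegral do rewrite ReD ReM.
  rewrite RintegralD//; last by apply: EFinSB; exact: EFinZ.
  by rewrite RintegralB ?RintegralZl//; exact: EFinZ.
rewrite ImD ImM /=.
under eq_Rintegral do rewrite ImD ImM.
rewrite RintegralD//; last by apply: EFinS; exact: EFinZ.
by rewrite RintegralD ?RintegralZl//; exact: EFinZ.
Qed.

Lemma cint_ae h k : cmeasurable D h -> cmeasurable D k ->
  {ae leb3, forall x, D x -> h x = k x} -> cint D h = cint D k.
Proof.
move=> [hr hi] [kr ki] hk; rewrite /cint /Rintegral.
congr (fine _ +i* fine _); apply: ae_eq_integral => //; try exact/measurable_EFinP.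
  by apply: ae_leb3S hk => x hkx Dx; rewrite hkx.
by apply: ae_leb3S hk => x hkx Dx; rewrite hkx.
Qed.

(** Real and imaginary parts are bounded separately by the integral of [b], whence the factor 2. *)
Lemma cint_bound h (b : R3 R -> R) : cintegrable D h ->
  (@leb3 R).-integrable (D : set (mR3 R)) (EFin \o b) ->
  (forall x, D x -> `|complex.Re (h x)| <= b x /\ `|complex.Im (h x)| <= b x) ->
  `|cint D h| <= (2 * \int[leb3]_(x in D) b x)%:C.
Proof.
move=> [hr hi] ib hb; apply: norm_le_ReIm => /=.
have aux (u : R3 R -> R) :
  (@leb3 R).-integrable (D : set (mR3 R)) (EFin \o u) ->
  (forall x, D x -> `|u x| <= b x) ->
  `|\int[leb3]_(x in D) u x| <= \int[leb3]_(x in D) b x.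
  move=> iu ub; apply: le_trans (le_normr_Rintegral mD iu) _.
  apply: le_Rintegral => //; exact: integrable_norm.
rewrite mulr_natl mulr2n lerD// aux// => x /hb[] //.
Qed.

Lemma L2s_integrable q : L2s D q ->
  (@leb3 R).-integrable (D : set (mR3 R)) (EFin \o (fun x => sqmod (q x))).
Proof.
move=> [mq qoo]; apply/integrableP; split.
  by apply/measurable_EFinP; exact: measurable_sqmod.
by under eq_integral do rewrite /= ger0_norm ?sqmod_ge0//.
Qed.

(** Linear combinations use both majorants; a bounded multiplier takes [r] and [s] equal. The
    domination is almost everywhere because essentially bounded coefficients give no more. *)
Lemma L2s_ae_le q r s : cmeasurable D q -> L2s D r -> L2s D s ->
  (exists C : R, {ae leb3, forall x, D x -> sqmod (q x) <= C * (sqmod (r x) + sqmod (s x))}) ->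
  L2s D q.
Proof.
move=> mq Lr Ls [C qC]; split=> //.
have iB : (@leb3 R).-integrable (D : set (mR3 R))
    (EFin \o (fun x => `|C| * (sqmod (r x) + sqmod (s x)))).
  have := integrableZl mD `|C| (integrableD mD (L2s_integrable Lr) (L2s_integrable Ls)).
  by [].
have [mB Boo] := elimT (integrableP _ _ _) iB.
apply: le_lt_trans Boo; apply: ae_ge0_le_integral => //.
- by move=> x _; rewrite lee_fin sqmod_ge0.
- by apply/measurable_EFinP; exact: measurable_sqmod.
- exact: measurableT_comp.
apply: ae_leb3S qC => x h Dx; rewrite /= lee_fin; apply: le_trans (h Dx) _.
apply: le_trans (ler_norm _) _; rewrite [leRHS]normrM normr_id -normrM//.
Qed.

Lemma L2s_linear (a : R[i]) q r : L2s D q -> L2s D r -> L2s D (fun x => a * q x + r x).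
Proof.
move=> Lq Lr; apply: (L2s_ae_le _ Lq Lr).
  by apply: cmeasurableD Lr.1; apply: cmeasurableM Lq.1; exact: cmeasurable_cst.
exists (2 * (sqmod a + 1)); apply: aeW => x _; apply: le_trans (sqmodD _ _) _.
rewrite sqmodM.
by have := sqmod_ge0 a; have := sqmod_ge0 (q x); have := sqmod_ge0 (r x); nra.
Qed.

Lemma L2s0 : L2s D (fun=> 0).
Proof.
split; first exact: cmeasurable_cst.
by under eq_integral do rewrite /sqmod /= expr0n addr0; rewrite integral0.
Qed.

Lemma L2s_sum (I : Type) (s : seq I) (q : I -> R3 R -> R[i]) :
  (forall i, L2s D (q i)) -> L2s D (fun x => \sum_(i <- s) q i x).
Proof.
move=> Lq; elim: s => [|i s IHs].
  by under eq_fun do rewrite big_nil; exact: L2s0.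
under eq_fun do rewrite big_cons.
by have := L2s_linear 1 (Lq i) IHs; under eq_fun do rewrite mul1r.
Qed.

Lemma L2s_mul_bounded m q (M : R) : cmeasurable D m -> L2s D q ->
  {ae leb3, forall x, D x -> `|m x| <= M%:C} -> L2s D (fun x => m x * q x).
Proof.
move=> mm Lq mM; apply: (L2s_ae_le _ Lq Lq); first exact: cmeasurableM mm Lq.1.
exists (M ^+ 2); apply: ae_leb3S mM => x h Dx; rewrite sqmodM.
have := sqmod_le_norm (h Dx); have := sqmod_ge0 (q x); have := sqr_ge0 M; nra.
Qed.

Lemma L2s_mul_conj q r : L2s D q -> L2s D r ->
  cintegrable D (fun x => q x * Num.conj (r x)).
Proof.
move=> Lq Lr.
have [mr mi] := cmeasurableM Lq.1 (cmeasurable_conj Lr.1).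
have iB := integrableD mD (L2s_integrable Lq) (L2s_integrable Lr).
split; apply: le_integrable iB => //; try exact/measurable_EFinP.
  move=> x _ /=; rewrite lee_fin [leRHS]ger0_norm; last by apply: addr_ge0; exact: sqmod_ge0.
  by have [+ _] := mul_conj_bound (q x) (r x) ltr01; rewrite invr1 !mul1r.
move=> x _ /=; rewrite lee_fin [leRHS]ger0_norm; last by apply: addr_ge0; exact: sqmod_ge0.
by have [_] := mul_conj_bound (q x) (r x) ltr01; rewrite invr1 !mul1r.
Qed.

End ComplexIntegral.

(** * Sesquilinear product and norm of square-integrable vector fields *)

Section L2Fields.
Context {R : realType}.
Variable D : set (R3 R).
Hypothesis mD : measurable (D : set (mR3 R)).
Implicit Types (u v w f : vfield R) (a : R[i]).

Lemma sqnorm_ge0 (z : 'cV[R[i]]_3) : 0 <= sqnorm z.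
Proof. by apply: sumr_ge0 => i _; exact: sqmod_ge0. Qed.

Lemma L2_coord v i : L2 D v -> L2s D (fun x => v x i 0).
Proof.
move=> [mv voo]; split=> //; apply: le_lt_trans voo.
apply: ge0_le_integral => //.
- by move=> x _; rewrite lee_fin sqmod_ge0.
- by apply/measurable_EFinP; exact: measurable_sqmod.
- apply/measurable_EFinP; apply: measurable_sum => j; exact: measurable_sqmod.
move=> x _; rewrite lee_fin /sqnorm (bigD1 i)//= lerDl.
by apply: sumr_ge0 => j _; exact: sqmod_ge0.
Qed.

Lemma L2_integrable v : (forall i, L2s D (fun x => v x i 0)) ->
  (@leb3 R).-integrable (D : set (mR3 R)) (EFin \o (fun x => sqnorm (v x))).
Proof.
move=> Lv.
rewrite (_ : _ \o _ = fun x => \sum_(i <- index_enum 'I_3) (sqmod (v x i 0))%:E)%E.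
  by apply: integrable_sum => // i _; exact: L2s_integrable (Lv i).
by apply/funext => x; rewrite /= sumEFin.
Qed.

Lemma L2_of_coord v : (forall i, L2s D (fun x => v x i 0)) -> L2 D v.
Proof.
move=> Lv; split=> [i|]; first by case: (Lv i).
have [_] := elimT (integrableP _ _ _) (L2_integrable Lv).
by under eq_integral do rewrite /= ger0_norm ?sqnorm_ge0//.
Qed.

Lemma L2_linear a v w : L2 D v -> L2 D w -> L2 D (a *: v + w).
Proof.
move=> Lv Lw; apply: L2_of_coord => i.
have := L2s_linear mD a (L2_coord i Lv) (L2_coord i Lw).
by under [X in _ -> L2s D X]eq_fun do rewrite !mxE.
Qed.

Lemma cintegrable_dot v w : L2 D v -> L2 D w ->
  cintegrable D (fun x => \sum_i v x i 0 * Num.conj (w x i 0)).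
Proof.
move=> Lv Lw; apply: cintegrable_sum => // i.
exact: L2s_mul_conj (L2_coord i Lv) (L2_coord i Lw).
Qed.

Lemma L2ip_linear_l a v w u : L2 D v -> L2 D w -> L2 D u ->
  L2ip D (a *: v + w) u = a * L2ip D v u + L2ip D w u.
Proof.
move=> Lv Lw Lu; rewrite /L2ip -cint_linear; [|exact: mD|exact: cintegrable_dot..].
congr cint; apply/funext => x; rewrite mulr_sumr -big_split /=.
by apply: eq_bigr => i _; rewrite !mxE; ring.
Qed.

Lemma L2ip_linear_r a v w u : L2 D v -> L2 D w -> L2 D u ->
  L2ip D u (a *: v + w) = Num.conj a * L2ip D u v + L2ip D u w.
Proof.
move=> Lv Lw Lu; rewrite /L2ip -cint_linear; [|exact: mD|exact: cintegrable_dot..].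
congr cint; apply/funext => x; rewrite mulr_sumr -big_split /=.
by apply: eq_bigr => i _; rewrite !mxE rmorphD rmorphM /=; ring.
Qed.

Lemma L2ip_ae v v' w w' : L2 D v -> L2 D v' -> L2 D w -> L2 D w' ->
  aeq D v v' -> aeq D w w' -> L2ip D v w = L2ip D v' w'.
Proof.
move=> Lv Lv' Lw Lw' vv' ww'; apply: cint_ae => //.
- by apply: cintegrable_cmeasurable => //; exact: cintegrable_dot.
- by apply: cintegrable_cmeasurable => //; exact: cintegrable_dot.
by apply: ae_leb3S2 vv' ww' => x hv hw Dx; rewrite hv// hw.
Qed.

Lemma L2norm_sq v : L2norm D v ^+ 2 = \int[leb3]_(x in D) sqnorm (v x).
Proof. by rewrite sqr_sqrtr// Rintegral_ge0// => x _; exact: sqnorm_ge0. Qed.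

(** A substitute for Cauchy-Schwarz. For t = |v| + e, with |.| the L2 norm, the sum t |f|^2 + t^-1
    |v|^2 is at most (|f|^2 + 1)(|v| + e), and e tends to 0. The result is linear in |v|, as
    boundedness of a functional requires; the factor 2 comes from [cint_bound]. *)
Lemma L2ip_bounded f : L2 D f ->
  exists2 C : R, 0 <= C & forall v, L2 D v -> `|L2ip D f v| <= (C * L2norm D v)%:C.
Proof.
move=> Lf; exists (2 * (L2norm D f ^+ 2 + 1)).
  by rewrite mulr_ge0// addr_ge0// sqr_ge0.
move=> v Lv.
have iq u : L2 D u -> (@leb3 R).-integrable (D : set (mR3 R)) (EFin \o (fun x => sqnorm (u x))).
  by move=> Lu; apply: L2_integrable => i; exact: L2_coord.
have iqZ u (c : R) : L2 D u ->
    (@leb3 R).-integrable (D : set (mR3 R)) (EFin \o (fun x => c * sqnorm (u x))).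
  by move=> Lu; have := integrableZl mD c (iq u Lu).
have key t : 0 < t ->
    `|L2ip D f v| <= (2 * (t * L2norm D f ^+ 2 + t^-1 * L2norm D v ^+ 2))%:C.
  move=> t0.
  have -> : t * L2norm D f ^+ 2 + t^-1 * L2norm D v ^+ 2 =
      \int[leb3]_(x in D) (t * sqnorm (f x) + t^-1 * sqnorm (v x)).
    rewrite RintegralD//; [|exact: iqZ..].
    by rewrite !RintegralZl ?L2norm_sq//; exact: iq.
  apply: cint_bound => //; first exact: cintegrable_dot.
    by have := integrableD mD (iqZ f t Lf) (iqZ v t^-1 Lv).
  move=> x _; rewrite !mulr_sumr -big_split /=.
  have ReS (z : 'I_3 -> R[i]) : complex.Re (\sum_i z i) = \sum_i complex.Re (z i).
    by by elim/big_rec2: _ => //= i y1 y2 _ <-; rewrite ReD.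
  have ImS (z : 'I_3 -> R[i]) : complex.Im (\sum_i z i) = \sum_i complex.Im (z i).
    by by elim/big_rec2: _ => //= i y1 y2 _ <-; rewrite ImD.
  rewrite ReS ImS; split; apply: le_trans (ler_norm_sum _ _ _) _;
    apply: ler_sum => i _; by have [] := mul_conj_bound (f x i 0) (v x i 0) t0.
(* The weight t is taken just above the norm of v, which may vanish. *)
have n0 : 0 <= L2norm D v by exact: sqrtr_ge0.
have : forall e, 0 < e -> `|L2ip D f v| <= (2 * (L2norm D f ^+ 2 + 1) * (L2norm D v + e))%:C.
  move=> e e0; have t0 : 0 < L2norm D v + e by rewrite ltr_wpDl.
  apply: le_trans (key _ t0) _; rewrite lecR -mulrA ler_pM2l//.
  rewrite [leRHS]mulrDl mul1r [X in _ <= X + _]mulrC lerD2l.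
  rewrite ler_pdivrMl// -expr2.
  by apply: lerXn2r; rewrite ?nnegrE ?lerDl ?addr_ge0 ?(ltW e0).
(* Writing the value as p + iq exposes its modulus as a real number, so the inequality moves to the
   order of R, where e can tend to 0. *)
case: (L2ip D f v) => p q; rewrite /Num.norm /= => h.
rewrite lecR; apply/ler_addgt0Pr => e e0.
pose K := 2 * (L2norm D f ^+ 2 + 1).
have K0 : 0 < K by rewrite mulr_gt0// ltr_wpDl ?sqr_ge0.
have := h (e / K) (divr_gt0 e0 K0); rewrite lecR -/K mulrDr => /le_trans; apply.
by rewrite mulrCA divff ?mulr1// gt_eqF.
Qed.

Lemma L2norm_eq0 v : L2 D v -> L2norm D v = 0 -> aeq D v (cst 0).
Proof.
move=> Lv v0.
have iv := L2_integrable (fun i => L2_coord i Lv).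
have : (\int[leb3]_(x in D) `|(EFin \o (fun x => sqnorm (v x))) x| = 0)%E.
  under eq_integral do rewrite /= ger0_norm ?sqnorm_ge0//.
  (* The norm is the root of a [fine] value; integrability turns its vanishing into that of the
     extended integral. *)
  have := L2norm_sq v; rewrite v0 expr0n /= /Rintegral => e.
  by rewrite -(fineK (integrable_fin_num mD iv)) /= -e.
move/(ae_eq_integral_abs (@leb3 R) mD (measurable_int _ iv)); apply: ae_leb3S => x h Dx.
have /eqP := h Dx; rewrite /= eqe /sqnorm psumr_eq0 => [/allP z|i _]; last exact: sqmod_ge0.
apply/matrixP => i j; rewrite ord1 mxE; apply: sqmod_eq0.
by apply/eqP; apply: z; rewrite mem_index_enum.
Qed.

Lemma L2_mulmx (kappa : R3 R -> 'M[R[i]]_3) v :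
  Linfty_complex D kappa -> L2 D v -> L2 D (fun x => kappa x *m v x).
Proof.
move=> [mk [M kM]] Lv; apply: L2_of_coord => i.
under eq_fun do rewrite mxE.
apply: L2s_sum => // j; apply: (L2s_mul_bounded mD (M := M)) => //.
  exact: L2_coord.
by apply: ae_leb3S kM => x h Dx; exact: h.
Qed.

Lemma Linfty_cplx (mu : R3 R -> 'M[R]_3) :
  Linfty_real D mu -> Linfty_complex D (fun x => cplx (mu x)).
Proof.
move=> [mm [M mM]]; split=> [i j|].
  split; first by under eq_fun do rewrite mxE /=; exact: mm.
  by under eq_fun do rewrite mxE /=; exact: measurable_cst.
exists M; apply: ae_leb3S mM => x h Dx i j; rewrite mxE; apply: norm_le_ReIm => /=.
by rewrite normr0 addr0; exact: h.
Qed.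

End L2Fields.

(** * Weak curls and the sesquilinear form *)

Section WeakCurl.
Context {R : realType}.
Variable Om : set (R3 R).
Hypotheses (oOm : open Om) (bOm : bounded_set Om).
Implicit Types (v w c : vfield R) (a : R[i]).

Let mOm : measurable (Om : set (mR3 R)) := measurable_open oOm.

(** [Om] lies in a compact box, on which phi is bounded and whose measure is finite. The statement
    covers functions without compact support because the traces in [H0curl] are tested up to the
    boundary. *)
Lemma L2s_continuous (phi : R3 R -> R) :
  continuous phi -> L2s Om (fun x => (phi x)%:C).
Proof.
move=> cphi; have [p [q Opq]] := bounded_sub_cbox bOm.
split; first by split; [exact: measurable_continuous|exact: measurable_cst].
have [M [_ phiM]] : bounded_set (phi @` cbox p q).
  apply/compact_bounded/continuous_compact; last exact: compact_cbox.
  exact: continuous_subspaceT.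
(* [bounded_set] grants the bound for constants strictly above [M], hence M + 1. *)
have phiN x : Om x -> `|phi x| <= M + 1.
  by move=> /Opq px; apply: phiM; [rewrite ltrDl|exists x].
have mq : measurable_fun (Om : set (mR3 R)) (fun x : mR3 R => sqmod (phi x)%:C).
  by apply: measurable_sqmod; split; [exact: measurable_continuous|exact: measurable_cst].
apply: (@le_lt_trans _ _ (\int[leb3]_(x in Om) ((M + 1) ^+ 2)%:E)%E).
  apply: ge0_le_integral => //.
  - by move=> x _; rewrite lee_fin sqmod_ge0.
  - exact/measurable_EFinP.
  move=> x Ox; rewrite lee_fin /sqmod /= expr0n addr0 -real_normK ?num_real//.
  by apply: lerXn2r; rewrite ?nnegrE// ?phiN// (le_trans _ (phiN _ Ox)).
rewrite integral_cst//; apply: (@le_lt_trans _ _ (((M + 1) ^+ 2)%:E * leb3 (cbox p q))%E).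
  apply: lee_wpmul2l; first by rewrite lee_fin sqr_ge0.
  by apply: le_measure => //; rewrite inE//; exact: measurable_cbox.
by rewrite lte_mul_pinfty ?lee_fin ?sqr_ge0// leb3_cbox_fin.
Qed.

Lemma L2_cplx (Phi : R3 R -> 'cV[R]_3) :
  (forall i, continuous (component Phi i)) -> L2 Om (fun x => cplx (Phi x)).
Proof.
move=> cPhi; apply: L2_of_coord => // i.
by under eq_fun do rewrite mxE; exact: L2s_continuous (cPhi i).
Qed.

Lemma conj_real (r : R) : Num.conj r%:C = r%:C.
Proof. by apply/eqP; rewrite eq_complex /= oppr0 !eqxx. Qed.

(** Test fields are real, hence fixed by conjugation, so the calculus of [L2ip] covers the bilinear
    pairing as well. *)
Lemma pairingE v (Phi : R3 R -> 'cV[R]_3) :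
  pairing Om v Phi = L2ip Om v (fun x => cplx (Phi x)).
Proof.
congr cint; apply/funext => x; apply: eq_bigr => i _.
by rewrite mxE conj_real.
Qed.

Lemma smooth_cst0 : smooth (cst 0 : R3 R -> R).
Proof.
apply: (@smooth_closed _ [set cst 0]) => // [_ ->|_ i x ->|_ i ->].
- exact: cst_continuous.
- exact: derivable_cst.
by apply/funext => x; rewrite /partial derive_cst.
Qed.

(** Fields with a single nonzero component reduce the claim to scalars, and real test functions
    separate real from imaginary parts. *)
Lemma L2_test_eq v w : L2 Om v -> L2 Om w ->
  (forall Phi : R3 R -> 'cV[R]_3,
    (forall i, smooth (component Phi i)) ->
    (forall i, compactly_supported Om (component Phi i)) ->
    pairing Om v Phi = pairing Om w Phi) ->
  aeq Om v w.
Proof.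
move=> Lv Lw vw.
have I1 (q : R3 R -> R[i]) (phi : R3 R -> R) : L2s Om q -> continuous phi ->
    cintegrable Om (fun x => q x * (phi x)%:C).
  move=> Lq cphi; have := L2s_mul_conj mOm Lq (L2s_continuous cphi).
  by under eq_fun do rewrite conj_real.
have I0 (q : R3 R -> R[i]) : L2s Om q -> cintegrable Om q.
  (* Integrability comes from pairing with the constant 1, which is square integrable because [Om]
     is bounded. *)
  move=> Lq; have := I1 q (cst 1) Lq (@cst_continuous _ _ _).
  by under eq_fun do rewrite mulr1.
have vwi i (phi : R3 R -> R) : smooth phi -> compactly_supported Om phi ->
    cint Om (fun x => v x i 0 * (phi x)%:C) = cint Om (fun x => w x i 0 * (phi x)%:C).
  move=> sphi kphi.
  pose Phi (x : R3 R) : 'cV[R]_3 := \col_j (if j == i then phi x else 0).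
  have PhiE j : component Phi j = if j == i then phi else cst 0.
    by apply/funext => x; rewrite /component mxE; case: ifP.
  have dotE (u : vfield R) x : \sum_j u x j 0 * (Phi x j 0)%:C = u x i 0 * (phi x)%:C.
    rewrite (bigD1 i)//= mxE eqxx big1 ?addr0// => j /negPf ji.
    by rewrite mxE ji mulr0.
  have := vw Phi; rewrite /pairing.
  under [X in _ -> _ -> cint Om X = _]eq_fun do rewrite dotE.
  under [X in _ -> _ -> _ = cint Om X]eq_fun do rewrite dotE.
  apply => j; rewrite PhiE; case: ifP => // _; first exact: smooth_cst0.
  by exists set0; split=> //; exact: compact0.
have ri i : {ae leb3, forall x, Om x -> complex.Re (v x i 0) - complex.Re (w x i 0) = 0}.
  have [Lvi Lwi] := (L2_coord mOm i Lv, L2_coord mOm i Lw).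
  apply: ae_eq0_test => // [|phi sphi kphi].
    by have := integrableB mOm (I0 _ Lvi).1 (I0 _ Lwi).1.
  have cphi := sphi 0%N.
  have := congr1 (@complex.Re R) (vwi i phi sphi kphi) => /= e.
  transitivity (\int[leb3]_(x in Om) (complex.Re (v x i 0 * (phi x)%:C)
                                    - complex.Re (w x i 0 * (phi x)%:C))).
    by apply: eq_Rintegral => x _; rewrite !ReM /= !mulr0 !subr0 mulrBl.
  by rewrite RintegralB ?e ?subrr//; [exact: (I1 _ _ Lvi cphi).1|exact: (I1 _ _ Lwi cphi).1].
have ii i : {ae leb3, forall x, Om x -> complex.Im (v x i 0) - complex.Im (w x i 0) = 0}.
  have [Lvi Lwi] := (L2_coord mOm i Lv, L2_coord mOm i Lw).
  apply: ae_eq0_test => // [|phi sphi kphi].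
    by have := integrableB mOm (I0 _ Lvi).2 (I0 _ Lwi).2.
  have cphi := sphi 0%N.
  have := congr1 (@complex.Im R) (vwi i phi sphi kphi) => /= e.
  transitivity (\int[leb3]_(x in Om) (complex.Im (v x i 0 * (phi x)%:C)
                                    - complex.Im (w x i 0 * (phi x)%:C))).
    by apply: eq_Rintegral => x _; rewrite !ImM /= !mulr0 !add0r mulrBl.
  by rewrite RintegralB ?e ?subrr//; [exact: (I1 _ _ Lvi cphi).2|exact: (I1 _ _ Lwi cphi).2].
have vi i : {ae leb3, forall x, Om x -> v x i 0 = w x i 0}.
  apply: ae_leb3S2 (ri i) (ii i) => x hr hi Ox.
  by apply/eqP; rewrite eq_complex -subr_eq0 hr// -[X in _ && X]subr_eq0 hi// !eqxx.
apply: ae_leb3S2 (vi 0) (ae_leb3S2 _ (vi 1) (vi 2)); last by move=> x h1 h2; exact: (conj h1 h2).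
move=> x h0 [h1 h2] Ox; apply/matrixP => i j; rewrite ord1.
by have [->|->|->] := ord3_cases i; [exact: h0|exact: h1|exact: h2].
Qed.

Lemma smooth_partial (phi : R3 R -> R) i : smooth phi -> continuous (partial i phi).
Proof. by move=> sphi; have [_] := sphi 1%N; exact. Qed.

Lemma L2_cplx_ccurl (Phi : R3 R -> 'cV[R]_3) :
  (forall i, smooth (component Phi i)) -> L2 Om (fun x => cplx (ccurl Phi x)).
Proof.
move=> sPhi; apply: L2_cplx => i.
rewrite (_ : component _ _ = fun x => partial (i + 1) (component Phi (i + 2)) x
          - partial (i + 2) (component Phi (i + 1)) x).
  by move=> x; apply: cvgB; exact: smooth_partial.
by apply/funext => x; rewrite /component mxE.
Qed.

Lemma L2_cplx_smooth (Phi : R3 R -> 'cV[R]_3) :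
  (forall i, smooth (component Phi i)) -> L2 Om (fun x => cplx (Phi x)).
Proof. by move=> sPhi; apply: L2_cplx => i; exact: (sPhi i 0%N). Qed.

Lemma is_weak_curl_linear a v w c d : L2 Om v -> L2 Om w ->
  is_weak_curl Om v c -> is_weak_curl Om w d ->
  is_weak_curl Om (a *: v + w) (a *: c + d).
Proof.
move=> Lv Lw [Lc vc] [Ld wd]; split; first exact: L2_linear.
move=> Phi sPhi kPhi; have [e1 e2] := (vc Phi sPhi kPhi, wd Phi sPhi kPhi).
move: e1 e2; rewrite !pairingE => e1 e2.
have [LP LC] := (L2_cplx_smooth sPhi, L2_cplx_ccurl sPhi).
by rewrite (L2ip_linear_l mOm a Lv Lw LC) (L2ip_linear_l mOm a Lc Ld LP) e1 e2.
Qed.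

Lemma curlP v : Hcurl Om v -> is_weak_curl Om v (curl Om v).
Proof. by move=> [_ vc]; exact: xgetPex. Qed.

Lemma L2_curl v : Hcurl Om v -> L2 Om (curl Om v).
Proof. by move=> /curlP[]. Qed.

Lemma Hcurl_linear a v w : Hcurl Om v -> Hcurl Om w -> Hcurl Om (a *: v + w).
Proof.
move=> Hv Hw; split; first exact: (L2_linear mOm _ Hv.1 Hw.1).
by exists (a *: curl Om v + curl Om w);
  exact: (is_weak_curl_linear _ Hv.1 Hw.1 (curlP Hv) (curlP Hw)).
Qed.

Lemma curl_linear a v w : Hcurl Om v -> Hcurl Om w ->
  aeq Om (curl Om (a *: v + w)) (a *: curl Om v + curl Om w).
Proof.
move=> Hv Hw; have Hvw := Hcurl_linear a Hv Hw.
have [L1 e1] := curlP Hvw.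
have [L2' e2] := is_weak_curl_linear a Hv.1 Hw.1 (curlP Hv) (curlP Hw).
by apply: L2_test_eq => // Phi sPhi kPhi; rewrite -e1// -e2.
Qed.

Lemma aeq_refl v : aeq Om v v.
Proof. exact: aeW. Qed.

Lemma L2ip_curl_linear_l a v w u : Hcurl Om v -> Hcurl Om w -> L2 Om u ->
  L2ip Om (curl Om (a *: v + w)) u = a * L2ip Om (curl Om v) u + L2ip Om (curl Om w) u.
Proof.
move=> Hv Hw Lu; have [Lv Lw] := (L2_curl Hv, L2_curl Hw).
rewrite -(L2ip_linear_l mOm a Lv Lw Lu).
apply: (L2ip_ae mOm _ _ Lu Lu (curl_linear a Hv Hw) (aeq_refl u)).
  exact/L2_curl/Hcurl_linear.
exact: (L2_linear mOm a Lv Lw).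
Qed.

(** The trace pairs the chosen [curl] with fields that may not vanish at the boundary, where the
    weak identity says nothing; the term is split by the almost everywhere linearity of [curl]. *)
Lemma H0curl_linear a v w : H0curl Om v -> H0curl Om w -> H0curl Om (a *: v + w).
Proof.
move=> [Hv tv] [Hw tw]; split=> [|Phi sPhi]; first exact: Hcurl_linear.
have := tv Phi sPhi; have := tw Phi sPhi; rewrite /tangential_trace !pairingE.
have LP := L2_cplx_smooth sPhi; have LC := L2_cplx_ccurl sPhi.
rewrite (L2ip_curl_linear_l a Hv Hw LP) (L2ip_linear_l mOm a Hv.1 Hw.1 LC).
move=> /eqP; rewrite subr_eq0 => /eqP -> /eqP; rewrite subr_eq0 => /eqP ->.
exact: subrr.
Qed.

(** * The form B: linearity, boundedness and coercivity *)

Variables (mu : R3 R -> 'M[R]_3) (kappa : R3 R -> 'M[R[i]]_3).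
Hypotheses (Lmu : Linfty_real Om mu) (Lkappa : Linfty_complex Om kappa).

Lemma L2_mu_curl v : Hcurl Om v -> L2 Om (fun x => cplx (mu x) *m curl Om v x).
Proof.
by move=> Hv; exact: (L2_mulmx mOm (Linfty_cplx Lmu) (L2_curl Hv)).
Qed.

Lemma Bform_linear_l a v w psi : Hcurl Om v -> Hcurl Om w -> Hcurl Om psi ->
  Bform Om mu kappa (a *: v + w) psi =
  a * Bform Om mu kappa v psi + Bform Om mu kappa w psi.
Proof.
move=> Hv Hw Hp; have Lp := L2_curl Hp.
have Lm := L2_mu_curl Hv; have Lm' := L2_mu_curl Hw.
have Lk := L2_mulmx mOm Lkappa Hv.1; have Lk' := L2_mulmx mOm Lkappa Hw.1.
rewrite /Bform.
have -> : L2ip Om (fun x => cplx (mu x) *m curl Om (a *: v + w) x) (curl Om psi) =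
    L2ip Om (a *: (fun x => cplx (mu x) *m curl Om v x)
                 + (fun x => cplx (mu x) *m curl Om w x)) (curl Om psi).
  apply: (L2ip_ae mOm _ _ Lp Lp _ (aeq_refl _)).
  - exact/L2_mu_curl/Hcurl_linear.
  - exact: (L2_linear mOm a Lm Lm').
  - apply: ae_leb3S (curl_linear a Hv Hw) => x h Ox.
    rewrite (h Ox) -[LHS]/(_ *m (a *: curl Om v x + curl Om w x)).
    by rewrite mulmxDr -scalemxAr.
have -> : (fun x => kappa x *m (a *: v + w) x) =
    a *: (fun x => kappa x *m v x) + (fun x => kappa x *m w x).
  apply/funext => x; rewrite -[LHS]/(_ *m (a *: v x + w x)).
  by rewrite mulmxDr -scalemxAr.
rewrite (L2ip_linear_l mOm a Lm Lm' Lp) (L2ip_linear_l mOm a Lk Lk' Hp.1).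
by rewrite mulrDr addrACA.
Qed.

Lemma Bform_linear_r a v w u : Hcurl Om v -> Hcurl Om w -> Hcurl Om u ->
  Bform Om mu kappa u (a *: v + w) =
  Num.conj a * Bform Om mu kappa u v + Bform Om mu kappa u w.
Proof.
move=> Hv Hw Hu; have [Lv Lw] := (L2_curl Hv, L2_curl Hw).
have Lm := L2_mu_curl Hu; have Lk := L2_mulmx mOm Lkappa Hu.1.
rewrite /Bform.
have -> : L2ip Om (fun x => cplx (mu x) *m curl Om u x) (curl Om (a *: v + w)) =
    L2ip Om (fun x => cplx (mu x) *m curl Om u x) (a *: curl Om v + curl Om w).
  apply: (L2ip_ae mOm Lm Lm _ _ (aeq_refl _) (curl_linear a Hv Hw)).
  - exact/L2_curl/Hcurl_linear.
  - exact: (L2_linear mOm a Lv Lw).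
rewrite (L2ip_linear_r mOm a Lv Lw Lm) (L2ip_linear_r mOm a Hv.1 Hw.1 Lk).
by rewrite mulrDr addrACA.
Qed.

Lemma L2norm_le_Hcurl_norm v :
  L2norm Om v <= Hcurl_norm Om v /\ L2norm Om (curl Om v) <= Hcurl_norm Om v.
Proof.
have s (x y : R) : 0 <= x -> x <= Num.sqrt (y ^+ 2 + x ^+ 2).
  move=> x0; rewrite -[leLHS](ger0_norm x0) -sqrtr_sqr ler_sqrt.
    by rewrite lerDr sqr_ge0.
  by rewrite addr_ge0 ?sqr_ge0.
split; first by apply: s; exact: sqrtr_ge0.
by rewrite /Hcurl_norm addrC; apply: s; exact: sqrtr_ge0.
Qed.

Lemma of_field_dual f : L2 Om f -> H0curl_dual Om (of_field Om f).
Proof.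
move=> Lf; split=> [a v w [Hv _] [Hw _]|].
  exact: (L2ip_linear_r mOm a Hv.1 Hw.1 Lf).
have [C C0 fC] := L2ip_bounded mOm Lf; exists C => v [Hv _].
apply: le_trans (fC v Hv.1) _; rewrite lecR ler_wpM2l//.
by have [] := L2norm_le_Hcurl_norm v.
Qed.

(** Each term of B is an L2 product of a fixed field, mu curl v or kappa v, with the curl of the
    argument or the argument itself; the constants of [L2ip_bounded] add up. *)
Lemma Lop_dual v : Hcurl Om v -> H0curl_dual Om (Lop Om mu kappa v).
Proof.
move=> Hv; split=> [a w w' [Hw _] [Hw' _]|]; first exact: Bform_linear_r.
have [C C0 mC] := L2ip_bounded mOm (L2_mu_curl Hv).
have [C' C0' kC] := L2ip_bounded mOm (L2_mulmx mOm Lkappa Hv.1).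
exists (C + C') => w [Hw _]; have [nw ncw] := L2norm_le_Hcurl_norm w.
apply: le_trans (ler_normD _ _) _; rewrite mulrDl rmorphD.
apply: lerD.
  by apply: le_trans (mC _ (L2_curl Hw)) _; rewrite lecR ler_wpM2l.
by apply: le_trans (kC _ Hw.1) _; rewrite lecR ler_wpM2l.
Qed.

Lemma coercive_eq0 (alpha : R) v : 0 < alpha -> coercive Om mu kappa alpha ->
  H0curl Om v -> Bform Om mu kappa v v = 0 -> aeq Om v (cst 0).
Proof.
move=> alpha0 coer Hv Bv0; apply: L2norm_eq0 => //; first exact: Hv.1.1.
have := coer v Hv; rewrite Bv0 normr0 lecR pmulr_rle0// => h.
have n0 : Hcurl_norm Om v = 0.
  by apply/eqP; rewrite -sqrf_eq0 eq_le h sqr_ge0.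
apply/eqP; rewrite eq_le sqrtr_ge0 andbT -n0.
by have [] := L2norm_le_Hcurl_norm v.
Qed.

End WeakCurl.

Theorem lemma5p2 (R : realType) (Om : set (R3 R)) (f : vfield R)
    (mu : R3 R -> 'M[R]_3) (kappa : R3 R -> 'M[R[i]]_3) (alpha : R)
    (N : nat) (T : 'I_N -> 'I_4 -> R3 R) (gamma : R) (Cpi : R -> R)
    (piE : vfield R -> vfield R) (G : dualfun R -> vfield R) (u : vfield R) :
  admissible_domain Om ->
  Hdiv Om f ->
  Linfty_real Om mu -> Linfty_complex Om kappa ->
  0 < alpha -> coercive Om mu kappa alpha ->
  regular_partition Om T -> shape_regular T gamma -> quasi_uniform T gamma ->
  falk_winther Om T (Cpi gamma) piE ->
  corrector_green Om mu kappa piE G ->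
  H0curl Om u ->
  (forall psi, H0curl Om psi -> Bform Om mu kappa u psi = L2ip Om f psi) ->
  let uH := piE u in
  aeq Om u (uH - G (Lop Om mu kappa uH) + G (of_field Om f)).
Proof.
move=> [oOm bOm _ _ _] [Lf _] Lmu Lkappa alpha0 coer _ _ _ fw green Hu eqn uH.
have lin := fw_linear fw.
have NuH : Ned Om T uH := fw_range fw Hu.
have HuH : H0curl Om uH := NuH.1.
have [[H1 p1] B1] := green _ (Lop_dual oOm bOm Lmu Lkappa HuH.1).
have [[H2 p2] B2] := green _ (of_field_dual oOm Lf).
set v1 := G _ in H1 p1 B1 *; set v2 := G _ in H2 p2 B2 *.
(* Every stage has the shape a v + w in which the linearity lemmas are stated; altogether e = -u +
   v2 - v1 + u_H. *)
pose e1 := (-1) *: v1 + uH; pose e2 := 1 *: v2 + e1; pose e := (-1) *: u + e2.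
have He1 : H0curl Om e1 by exact: H0curl_linear.
have He2 : H0curl Om e2 by exact: H0curl_linear.
have He : H0curl Om e by exact: H0curl_linear.
have pe : aeq Om (piE e) (cst 0).
  (* Six almost everywhere facts are intersected: three splittings by linearity of [piE], the fixed
     point u_H and two kernel conditions. *)
  have q1 := ae_leb3S2 (fun x a b => conj a b) (lin (-1) u e2 Hu He2) (lin 1 v2 e1 H2 He1).
  have q2 := ae_leb3S2 (fun x a b => conj a b) (lin (-1) v1 uH H1 HuH) (fw_proj fw NuH).
  have q3 := ae_leb3S2 (fun x a b => conj a b) p1 p2.
  apply: ae_leb3S2 q1 (ae_leb3S2 (fun x a b => conj a b) q2 q3).
  move=> x [h1 h2] [[h3 h4] [h5 h6]] Ox.
  rewrite (h1 Ox) !fctE (h2 Ox) !fctE (h6 Ox) (h3 Ox) !fctE (h5 Ox) (h4 Ox) /=.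
  by rewrite !scaler0 !add0r scaleN1r addNr.
have Be : Bform Om mu kappa e e = 0.
  have [Cu Ce C1 C2 CuH] :
      [/\ Hcurl Om u, Hcurl Om e, Hcurl Om v1, Hcurl Om v2 & Hcurl Om uH].
    by split; [exact: Hu.1|exact: He.1|exact: H1.1|exact: H2.1|exact: HuH.1].
  (* Only the first slot is expanded, e staying in the second as test field: the terms are -(f, e) +
     (f, e) - B(u_H, e) + B(u_H, e). *)
  rewrite {1}/e Bform_linear_l//; last exact: He2.1.
  rewrite {1}/e2 Bform_linear_l//; last exact: He1.1.
  rewrite {1}/e1 Bform_linear_l// eqn// (B1 e (conj He pe)) (B2 e (conj He pe)).
  by rewrite /Lop /of_field mul1r !mulN1r addNr addr0 addNr.
apply: ae_leb3S (coercive_eq0 oOm alpha0 coer He Be) => x h Ox.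
have := h Ox; rewrite /e /e2 /e1 !fctE /= scaleN1r addrC scaleN1r scale1r => /eqP.
rewrite subr_eq0 => /eqP <-.
by rewrite addrC [X in X + _]addrC.
Qed.
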